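(* Let $\mathbb C[x_1,\ldots,x_n]$ be a polynomial ring with $n\le 3$ and let $I$ be an integrally closed zero-dimensional monomial ideal. Then $$\nu_I=\sum_v v(I),$$ where the sum is taken over all Rees valuations $v$ of $I$.
   Context: Write $R=\mathbb C[x_1,\ldots,x_n]$. $\nu_I$ is the value at the unique closed point of the Behrend function of $X=\operatorname{Spec}(R/I)$. With $G=\operatorname{gr}_I(R)=\bigoplus_{j\ge0}I^j/I^{j+1}$ and $A=R/I$, Behrend's formula is $\nu_X=\sum_{\mathfrak P}(-1)^{\dim(A/\mathfrak P\cap A)}\lambda(G_{\mathfrak P})\operatorname{Eu}([\mathfrak P\cap A])$, sum over the minimal primes of $G$, with $\lambda$ length and $\operatorname{Eu}$ MacPherson's local Euler obstruction; for zero-dimensional $I$ this reads $\nu_I=\sum_{\mathfrak P}\lambda(G_{\mathfrak P})$, which may be taken as the definition of $\nu_I$. Let $\mathcal R=R[It]\subset R[t]$ be the Rees ring and $\overline{\mathcal R}=\bigoplus_{j\ge0}\overline{I^j}t^j$ its integral closure. The Rees valuations of $I$ are the normalized valuations of the discrete valuation rings $\overline{\mathcal R}_{\mathfrak Q}$, $\mathfrak Q$ ranging over the minimal primes of $I\overline{\mathcal R}$; $v(I)=\min\{v(f):f\in I\}$. For monomial $I$ they correspond to the non-coordinate supporting hyperplanes of the facets of the Newton polyhedron of $I$: a hyperplane $\ell_1y_1+\cdots+\ell_ny_n=M$ with nonnegative integers $\ell_j,M$ and $\gcd(\ell_1,\dots,\ell_n,M)=1$ gives the monomial valuation with $v(x_j)=\ell_j$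 and $v(I)=M$. *)

(* Defs.v *)
From HB Require Import structures.
From mathcomp Require Import all_boot all_order all_algebra generic_quotient.
From mathcomp Require Import complex mpoly ring.
From mathcomp Require Import boolp classical_sets reals.
From mathcomp Require Import constructive_ereal ereal esum.

Set Implicit Arguments.
Unset Strict Implicit.
Unset Printing Implicit Defensive.

Import Order.TTheory GRing.Theory Num.Theory.
Local Open Scope classical_set_scope.
Local Open Scope ring_scope.
Local Open Scope quotient_scope.

Section Ideals.
Variable A : comPzRingType.
Implicit Types (I J K S : set A) (a b c : A).

Definition is_ideal J : Prop :=
  [/\ J 0, forall a b, J a -> J b -> J (a + b) & forall a b, J b -> J (a * b)].

Record ideal := Ideal { ideal_set :> set A; idealP : is_ideal ideal_set }.

Definition is_prime_ideal P : Prop :=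
  [/\ is_ideal P, ~ P 1 & forall a b, P (a * b) -> P a \/ P b].

Record spec :=
  Spec { prime_set :> set A; primeP : is_prime_ideal prime_set }.

HB.instance Definition _ := gen_eqMixin spec.
HB.instance Definition _ := gen_choiceMixin spec.

Definition minimal_primes J : set spec :=
  [set P | J `<=` P /\ forall Q : spec, J `<=` Q -> Q `<=` P -> P `<=` Q].

Definition ideal_gen S : set A := smallest is_ideal S.

Definition ideal_mul J K : set A :=
  ideal_gen [set c | exists a b, [/\ J a, K b & c = a * b]].

Definition ideal_exp J (k : nat) : set A := iter k (ideal_mul J) setT.

(* f^m + a_1 f^(m-1) + ... + a_m = 0 with a_i in J^i *)
Definition integral_closure J : set A :=
  [set f | exists (m : nat) (a : nat -> A),
    [/\ (0 < m)%N,
        forall i, (0 < i <= m)%N -> ideal_exp J i (a i) &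
        f ^+ m + \sum_(1 <= i < m.+1) a i * f ^+ (m - i) = 0]].

Definition integrally_closed J : Prop := integral_closure J = J.

Lemma ideal0 J : is_ideal J -> J 0. Proof. by case. Qed.

Lemma idealD J a b : is_ideal J -> J a -> J b -> J (a + b).
Proof. by case=> _ + _; apply. Qed.

Lemma idealM J a b : is_ideal J -> J b -> J (a * b).
Proof. by case=> _ _; apply. Qed.

Lemma idealN J a : is_ideal J -> J a -> J (- a).
Proof. by move=> iJ Ja; rewrite -mulN1r; apply: idealM. Qed.

Lemma ideal_sum J (T : Type) (r : seq T) (p : pred T) (F : T -> A) :
  is_ideal J -> (forall i, p i -> J (F i)) -> J (\sum_(i <- r | p i) F i).
Proof.
move=> iJ JF; apply: (big_ind (fun x => J x)) => //; first exact: ideal0.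
by move=> x y; apply: idealD.
Qed.

Lemma ideal_gen_ideal S : is_ideal (ideal_gen S).
Proof.
split=> [|a b Ia Ib|a b Ib] M [iM SM]; first exact: ideal0.
  by apply: idealD => //; [apply: Ia | apply: Ib].
by apply: idealM => //; apply: Ib.
Qed.

Lemma sub_ideal_gen S : S `<=` ideal_gen S.
Proof. by move=> a Sa M [_]; apply. Qed.

Lemma ideal_gen_sub S J : is_ideal J -> S `<=` J -> ideal_gen S `<=` J.
Proof. by move=> iJ SJ a; apply. Qed.

Lemma ideal_exp_ideal J k : is_ideal (ideal_exp J k).
Proof. by case: k => [|k]; [split | exact: ideal_gen_ideal]. Qed.

Lemma ideal_expS J k a b : J a -> ideal_exp J k b -> ideal_exp J k.+1 (a * b).
Proof. by move=> Ja Jb; apply: sub_ideal_gen; exists a, b. Qed.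

Lemma ideal_expS_sub J K k : is_ideal K ->
    (forall a b, J a -> ideal_exp J k b -> K (a * b)) ->
  ideal_exp J k.+1 `<=` K.
Proof. by move=> iK JK; apply: ideal_gen_sub => // _ [a [b [Ja Jb ->]]]; exact: JK. Qed.

Lemma is_ideal_preim J b : is_ideal J -> is_ideal [set a | J (a * b)].
Proof.
move=> iJ; split=> /= [|x y Jx Jy|x y Jy]; first by rewrite mul0r; apply: ideal0.
    by rewrite mulrDl; apply: idealD.
by rewrite -mulrA; apply: idealM.
Qed.

Lemma ideal_expD J i j a b :
  ideal_exp J i a -> ideal_exp J j b -> ideal_exp J (i + j) (a * b).
Proof.
move=> + Jb; elim: i a => [|i IH] a.
  by move=> _; exact: idealM (ideal_exp_ideal _ _) Jb.
have iK := is_ideal_preim b (ideal_exp_ideal J (i + j).+1).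
rewrite addSn; apply: (ideal_expS_sub iK).
by move=> x y Jx Jy /=; rewrite -mulrA; exact: ideal_expS Jx (IH _ Jy).
Qed.

Lemma ideal_exp_add_sub J K i j : is_ideal K ->
    (forall a b, ideal_exp J i a -> ideal_exp J j b -> K (a * b)) ->
  ideal_exp J (i + j) `<=` K.
Proof.
elim: i K => [|i IH] K iK JK.
  by move=> b Jb; rewrite -[b]mul1r; apply: JK.
rewrite addSn; apply: ideal_expS_sub => // x y Jx Jy; rewrite mulrC.
apply: (IH [set y | K (y * x)]) Jy; first exact: is_ideal_preim.
by move=> a b Ja Jb /=; rewrite mulrC mulrA; apply: JK => //; apply: ideal_expS.
Qed.

Lemma ideal_expM J i j : ideal_exp (ideal_exp J j) i = ideal_exp J (i * j).
Proof.
elim: i => [//|i IH]; rewrite mulSn; apply/seteqP; split.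
  apply: ideal_expS_sub; first exact: ideal_exp_ideal.
  by move=> a b Ja; rewrite IH; apply: ideal_expD.
apply: ideal_exp_add_sub; first exact: ideal_exp_ideal.
by move=> a b Ja; rewrite -IH; apply: ideal_expS.
Qed.

Lemma ideal_expS_decr J k : ideal_exp J k.+1 `<=` ideal_exp J k.
Proof.
apply: ideal_expS_sub; first exact: ideal_exp_ideal.
by move=> a b _ Jb; exact: idealM (ideal_exp_ideal _ _) Jb.
Qed.

End Ideals.

Section Quotient.
Variables (A : comPzRingType) (J : ideal A).

Definition quot_eqv (a b : A) : bool := `[< ideal_set J (a - b) >].

Lemma quot_eqv_refl : reflexive quot_eqv.
Proof. by move=> a; apply/asboolP; rewrite subrr; apply: ideal0 (idealP J). Qed.

Lemma quot_eqv_sym : ssrbool.symmetric quot_eqv.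
Proof.
have impl a b : quot_eqv a b -> quot_eqv b a.
  by move=> /asboolP Jab; apply/asboolP; rewrite -opprB; apply: idealN (idealP J) _.
by move=> a b; apply/idP/idP; exact: impl.
Qed.

Lemma quot_eqv_trans : transitive quot_eqv.
Proof.
move=> b a c /asboolP Jab /asboolP Jbc; apply/asboolP.
by rewrite -[a - c](subrKA b) addrC; apply: idealD (idealP J) _ _; rewrite // addrC.
Qed.

Canonical quot_eqv_equiv :=
  EquivRel quot_eqv quot_eqv_refl quot_eqv_sym quot_eqv_trans.

Definition quot_ring := {eq_quot quot_eqv}.

HB.instance Definition _ : EqQuotient _ quot_eqv quot_ring :=
  EqQuotient.on quot_ring.
HB.instance Definition _ := Choice.on quot_ring.

Definition quot_zero : quot_ring := lift_cst quot_ring 0.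
Definition quot_one : quot_ring := lift_cst quot_ring 1.
Definition quot_add := lift_op2 quot_ring +%R.
Definition quot_opp := lift_op1 quot_ring -%R.
Definition quot_mul := lift_op2 quot_ring *%R.

Canonical quot_zero_morph := PiConst quot_zero.
Canonical quot_one_morph := PiConst quot_one.

Lemma quot_reprP (a : A) : ideal_set J (a - repr (\pi_quot_ring a)).
Proof. by apply/asboolP; change (quot_eqv a (repr (\pi_quot_ring a))); apply/eqmodP; rewrite reprK. Qed.

Lemma pi_quot_add : {morph \pi : a b / a + b >-> quot_add a b}.
Proof.
move=> a b; unlock quot_add; apply/eqmodP/asboolP.
set a' := repr _; set b' := repr _.
have -> : a + b - (a' + b') = (a - a') + (b - b') by ring.
by apply: idealD (idealP J) (quot_reprP a) (quot_reprP b).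
Qed.
Canonical pi_quot_add_morph := PiMorph2 pi_quot_add.

Lemma pi_quot_opp : {morph \pi : a / - a >-> quot_opp a}.
Proof.
move=> a; unlock quot_opp; apply/eqmodP/asboolP; rewrite -opprD.
exact: idealN (idealP J) (quot_reprP a).
Qed.
Canonical pi_quot_opp_morph := PiMorph1 pi_quot_opp.

Lemma pi_quot_mul : {morph \pi : a b / a * b >-> quot_mul a b}.
Proof.
move=> a b; unlock quot_mul; apply/eqmodP/asboolP.
set a' := repr _; set b' := repr _.
have -> : a * b - a' * b' = b * (a - a') + a' * (b - b') by ring.
apply: idealD (idealP J) _ _; apply: idealM (idealP J) _.
  exact: quot_reprP.
exact: quot_reprP.
Qed.
Canonical pi_quot_mul_morph := PiMorph2 pi_quot_mul.

Lemma quot_addA : associative quot_add.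
Proof. by elim/quotW=> x; elim/quotW=> y; elim/quotW=> z; rewrite !piE addrA. Qed.
Lemma quot_addC : commutative quot_add.
Proof. by elim/quotW=> x; elim/quotW=> y; rewrite !piE addrC. Qed.
Lemma quot_add0 : left_id quot_zero quot_add.
Proof. by elim/quotW=> x; rewrite !piE add0r. Qed.
Lemma quot_addN : left_inverse quot_zero quot_opp quot_add.
Proof. by elim/quotW=> x; rewrite !piE addNr. Qed.

HB.instance Definition _ :=
  GRing.isZmodule.Build quot_ring quot_addA quot_addC quot_add0 quot_addN.

Lemma quot_mulA : associative quot_mul.
Proof. by elim/quotW=> x; elim/quotW=> y; elim/quotW=> z; rewrite !piE mulrA. Qed.
Lemma quot_mulC : commutative quot_mul.
Proof. by elim/quotW=> x; elim/quotW=> y; rewrite !piE mulrC. Qed.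
Lemma quot_mul1 : left_id quot_one quot_mul.
Proof. by elim/quotW=> x; rewrite !piE mul1r. Qed.
Lemma quot_mulD : left_distributive quot_mul quot_add.
Proof. by elim/quotW=> x; elim/quotW=> y; elim/quotW=> z; rewrite !piE mulrDl. Qed.

HB.instance Definition _ := GRing.Zmodule_isComPzRing.Build quot_ring
  quot_mulA quot_mulC quot_mul1 quot_mulD.

End Quotient.

Section Localization.
Variables (A : comPzRingType) (P : spec A).

Record fracs := Frac { num : A; den : A; den_notin : ~ prime_set P den }.

HB.instance Definition _ := gen_eqMixin fracs.
HB.instance Definition _ := gen_choiceMixin fracs.

Lemma notin_prime1 : ~ prime_set P 1.
Proof. by case: (primeP P). Qed.

Lemma notin_primeM a b : ~ prime_set P a -> ~ prime_set P b -> ~ prime_set P (a * b).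
Proof. by move=> Pa Pb; case: (primeP P) => _ _ PM /PM[]. Qed.

Definition loc_eqv (x y : fracs) : bool :=
  `[< exists2 u, ~ prime_set P u & u * (num x * den y) = u * (num y * den x) >].

Lemma loc_eqv_refl : reflexive loc_eqv.
Proof. by move=> x; apply/asboolP; exists 1 => //; exact: notin_prime1. Qed.

Lemma loc_eqv_sym : ssrbool.symmetric loc_eqv.
Proof.
have impl x y : loc_eqv x y -> loc_eqv y x.
  by move=> /asboolP[u Pu e]; apply/asboolP; exists u.
by move=> x y; apply/idP/idP; exact: impl.
Qed.

Lemma loc_eqv_trans : transitive loc_eqv.
Proof.
move=> y x z /asboolP[u Pu exy] /asboolP[v Pv eyz]; apply/asboolP.
exists (u * v * den y).
  exact (notin_primeM (notin_primeM Pu Pv) (@den_notin y)).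
transitivity (v * den z * (u * (num x * den y))); first by ring.
rewrite exy; transitivity (u * den x * (v * (num y * den z))); first by ring.
by rewrite eyz; ring.
Qed.

Canonical loc_eqv_equiv :=
  EquivRel loc_eqv loc_eqv_refl loc_eqv_sym loc_eqv_trans.

Definition loc := {eq_quot loc_eqv}.

HB.instance Definition _ : EqQuotient _ loc_eqv loc := EqQuotient.on loc.
HB.instance Definition _ := Choice.on loc.

Definition frac_of (a : A) : fracs := Frac a notin_prime1.
Definition frac_add (x y : fracs) : fracs :=
  Frac (num x * den y + num y * den x)
       (notin_primeM (@den_notin x) (@den_notin y)).
Definition frac_opp (x : fracs) : fracs := Frac (- num x) (@den_notin x).
Definition frac_mul (x y : fracs) : fracs :=
  Frac (num x * num y) (notin_primeM (@den_notin x) (@den_notin y)).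

Definition to_loc := lift_embed loc frac_of.
Definition loc_add := lift_op2 loc frac_add.
Definition loc_opp := lift_op1 loc frac_opp.
Definition loc_mul := lift_op2 loc frac_mul.

Canonical to_loc_morph := PiEmbed to_loc.

Lemma loc_reprP (x : fracs) : exists2 u, ~ prime_set P u &
  u * (num x * den (repr (\pi_loc x))) = u * (num (repr (\pi_loc x)) * den x).
Proof. by apply/asboolP; change (loc_eqv x (repr (\pi_loc x))); apply/eqmodP; rewrite reprK. Qed.

Lemma pi_loc_add : {morph \pi : x y / frac_add x y >-> loc_add x y}.
Proof.
move=> x y; unlock loc_add; apply/eqmodP/asboolP => /=.
have [u Pu] := loc_reprP x; have [v Pv] := loc_reprP y.
move: (repr (\pi x)) (repr (\pi y)) => x' y' ey ex; exists (u * v).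
  exact (notin_primeM Pu Pv).
transitivity (v * (den y * den y') * (u * (num x * den x'))
              + u * (den x * den x') * (v * (num y * den y'))); first by ring.
by rewrite ex ey; ring.
Qed.
Canonical pi_loc_add_morph := PiMorph2 pi_loc_add.

Lemma pi_loc_opp : {morph \pi : x / frac_opp x >-> loc_opp x}.
Proof.
move=> x; unlock loc_opp; apply/eqmodP/asboolP => /=.
have [u Pu] := loc_reprP x; move: (repr (\pi x)) => x' ex; exists u => //.
by rewrite !mulNr !mulrN ex.
Qed.
Canonical pi_loc_opp_morph := PiMorph1 pi_loc_opp.

Lemma pi_loc_mul : {morph \pi : x y / frac_mul x y >-> loc_mul x y}.
Proof.
move=> x y; unlock loc_mul; apply/eqmodP/asboolP => /=.
have [u Pu] := loc_reprP x; have [v Pv] := loc_reprP y.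
move: (repr (\pi x)) (repr (\pi y)) => x' y' ey ex; exists (u * v).
  exact (notin_primeM Pu Pv).
transitivity ((u * (num x * den x')) * (v * (num y * den y'))); first by ring.
by rewrite ex ey; ring.
Qed.
Canonical pi_loc_mul_morph := PiMorph2 pi_loc_mul.

Let loc_pi_eq (x y : fracs) :
  num x * den y = num y * den x -> \pi_loc x = \pi_loc y.
Proof.
by move=> e; apply/eqmodP/asboolP; exists 1; [exact: notin_prime1|rewrite e].
Qed.

Lemma loc_addA : associative loc_add.
Proof.
elim/quotW=> x; elim/quotW=> y; elim/quotW=> z; rewrite !piE.
by apply: loc_pi_eq => /=; ring.
Qed.
Lemma loc_addC : commutative loc_add.
Proof.
by elim/quotW=> x; elim/quotW=> y; rewrite !piE; apply: loc_pi_eq => /=; ring.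
Qed.
Lemma loc_add0 : left_id (to_loc 0) loc_add.
Proof. by elim/quotW=> x; rewrite !piE; apply: loc_pi_eq => /=; ring. Qed.
Lemma loc_addN : left_inverse (to_loc 0) loc_opp loc_add.
Proof. by elim/quotW=> x; rewrite !piE; apply: loc_pi_eq => /=; ring. Qed.

HB.instance Definition _ :=
  GRing.isZmodule.Build loc loc_addA loc_addC loc_add0 loc_addN.

Lemma loc_mulA : associative loc_mul.
Proof.
elim/quotW=> x; elim/quotW=> y; elim/quotW=> z; rewrite !piE.
by apply: loc_pi_eq => /=; ring.
Qed.
Lemma loc_mulC : commutative loc_mul.
Proof.
by elim/quotW=> x; elim/quotW=> y; rewrite !piE; apply: loc_pi_eq => /=; ring.
Qed.
Lemma loc_mul1 : left_id (to_loc 1) loc_mul.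
Proof. by elim/quotW=> x; rewrite !piE; apply: loc_pi_eq => /=; ring. Qed.
Lemma loc_mulD : left_distributive loc_mul loc_add.
Proof.
elim/quotW=> x; elim/quotW=> y; elim/quotW=> z; rewrite !piE.
by apply: loc_pi_eq => /=; ring.
Qed.

HB.instance Definition _ := GRing.Zmodule_isComPzRing.Build loc
  loc_mulA loc_mulC loc_mul1 loc_mulD.

End Localization.

Section Invariants.
Variables (R : realType) (A : comPzRingType).

(* The length of A as a module over itself; its submodules are the ideals. *)
Definition ring_length : \bar R :=
  ereal_sup [set (k%:R)%:E | k in [set k : nat | exists J : nat -> ideal A,
    forall i, (i < k)%N -> J i `<` J i.+1]].

(* Equal to -oo on the zero ring. *)
Definition krull_dim : \bar R :=
  ereal_sup [set (k%:R)%:E | k in [set k : nat | exists P : nat -> spec A,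
    forall i, (i < k)%N -> P i `<` P i.+1]].

(* A is a discrete valuation ring and v, extended to the fraction field of A,
   is its normalized valuation. *)
Definition dvr_valuation (v : A -> \bar R) : Prop :=
  [/\ forall a, v a = +oo%E <-> a = 0,
      forall a, a <> 0 -> exists k : nat, v a = (k%:R)%:E,
      forall a b, v (a * b) = (v a + v b)%E,
      forall a b, (Order.min (v a) (v b) <= v (a + b)%R)%E &
      (exists a, v a = 1%E) /\
      forall a b, (v a <= v b)%E -> exists c, b = c * a].

End Invariants.

Section ReesAlgebras.
Variable A : comNzRingType.
Implicit Types (I J : ideal A).

Definition rees_pred I : {pred {poly A}} :=
  [pred p : {poly A} | `[< forall j, ideal_exp I j p`_j >]].

Lemma rees_subring I : subring_closed (rees_pred I).
Proof.
split=> [|p q|p q].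
- apply/asboolP=> -[//|j]; rewrite coef1; exact: ideal0 (ideal_exp_ideal _ _).
- move=> /asboolP Ip /asboolP Iq; apply/asboolP=> j; rewrite coefB.
  by apply: idealD (ideal_exp_ideal _ _) (Ip j) (idealN (ideal_exp_ideal _ _) (Iq j)).
- move=> /asboolP Ip /asboolP Iq; apply/asboolP=> j; rewrite coefM.
  apply: ideal_sum (ideal_exp_ideal _ _) _ => i _.
  by rewrite -[X in ideal_exp _ X](subnKC (ltnSE (ltn_ord i))); apply: ideal_expD.
Qed.

HB.instance Definition _ I :=
  GRing.isSubringClosed.Build {poly A} (rees_pred I) (rees_subring I).

(* The Rees ring A[It], consisting of the p in A[t] whose coefficient of t^j
   lies in I^j. *)
Record rees I := Rees { rees_poly : {poly A}; _ : rees_poly \in rees_pred I }.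

HB.instance Definition _ I := [isSub for @rees_poly I].
HB.instance Definition _ I := [Choice of rees I by <:].
HB.instance Definition _ I := [SubChoice_isSubComNzRing of rees I by <:].

Definition rees_val I : rees I -> {poly A} := \val.
HB.instance Definition _ I := GRing.RMorphism.copy (@rees_val I) \val.

Lemma rees_valP I (p : rees I) j : ideal_exp I j (rees_val p)`_j.
Proof. by have /asboolP := valP p. Qed.

Definition gr_ideal_set I : set (rees I) :=
  [set p | forall j, ideal_exp I j.+1 (rees_val p)`_j].

Lemma gr_ideal_subproof I : is_ideal (@gr_ideal_set I).
Proof.
split=> [j|p q Ip Iq j|p q Iq j].
- by rewrite rmorph0 coef0; exact: ideal0 (ideal_exp_ideal _ _).
- by rewrite rmorphD coefD; exact: idealD (ideal_exp_ideal _ _) (Ip j) (Iq j).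
- rewrite rmorphM coefM; apply: ideal_sum (ideal_exp_ideal _ _) _ => i _.
  have /ideal_expD/(_ (Iq (j - i)%N)) := rees_valP p i.
  by rewrite addnS subnKC // (ltnSE (ltn_ord i)).
Qed.

Definition gr_ideal I : ideal (rees I) := Ideal (gr_ideal_subproof I).

(* The direct sum of the I^j/I^(j+1), as the quotient of the direct sum of the
   I^j t^j by the direct sum of the I^(j+1) t^j. *)
Definition gr I : comPzRingType := quot_ring (gr_ideal I).

Definition rees_ic_pred I : {pred {poly A}} :=
  [pred p : {poly A} | `[< forall j, integral_closure (ideal_exp I j) p`_j >]].

Lemma integral_closure_integralOver I j f :
  integral_closure (ideal_exp I j) f <->
  integralOver (@rees_val I) (f *: 'X^j).
Proof.
split=> [[m [a [m_gt0 Ja fa]]]|[q q_monic /rootP qf]].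
  pose b k : {poly A} := if k == m then 1 else a (m - k)%N *: 'X^((m - k) * j).
  have Ib k : (k <= m)%N -> b k \in rees_pred I.
    move=> le_km; rewrite /b; case: eqP => [_|/eqP neq_km]; first exact: rpred1.
    apply/asboolP => i; rewrite coefZ coefXn; case: eqP => [->|_]; last first.
      by rewrite mulr0; exact: ideal0 (ideal_exp_ideal _ _).
    rewrite mulr1 -ideal_expM; apply: Ja.
    by rewrite subn_gt0 ltn_neqAle neq_km le_km leq_subr.
  pose c k : rees I := insubd 0 (b k).
  have vc k : (k <= m)%N -> rees_val (c k) = b k.
    by move=> le_km; rewrite /rees_val /c insubdK //; apply: Ib.
  have cm : c m = 1 by apply: val_inj; rewrite [LHS]vc // /b eqxx rmorph1.
  exists (\poly_(k < m.+1) c k).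
    by rewrite monicE lead_coef_poly // ?cm ?oner_eq0.
  apply/rootP; rewrite (@horner_coef_wide _ m.+1); last first.
    exact: leq_trans (size_poly _ _) (size_poly _ _).
  have fX k : (f *: 'X^j) ^+ k = f ^+ k *: 'X^(j * k).
    by rewrite exprZn -exprM.
  rewrite big_ord_recr /= coef_map coef_poly ltnSn /= vc // /b eqxx mul1r fX.
  transitivity ((\sum_(1 <= i < m.+1) a i * f ^+ (m - i) + f ^+ m)
                *: 'X^(j * m) : {poly A}); last by rewrite addrC fa scale0r.
  rewrite scalerDl; congr (_ + _); rewrite scaler_suml big_add1 big_nat_rev /=.
  rewrite big_mkord; apply: eq_bigr => -[k lt_km] _ /=; rewrite add0n.
  have le_km := ltnW lt_km; rewrite coef_map coef_poly ltnS le_km /= vc // /b.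
  rewrite (ltn_eqF lt_km) fX.
  rewrite -scalerAl -scalerAr scalerA -exprD; congr (_ * _ *: 'X^_).
  - by congr (a _); rewrite -subSn // subSS.
  - by congr (f ^+ _); rewrite -subSn // subSS subKn.
  - by rewrite mulnC -mulnDr subnK.
have m_gt0 : (0 < (size q).-1)%N.
  rewrite lt0n; apply/eqP => q1; have q_eq1 : q = 1.
    have /eqP/size_poly1P[c _ qc] : size q = 1%N.
      by move: q1; have := monic_neq0 q_monic; rewrite -size_poly_eq0; case: size => // -[].
    by move: q_monic; rewrite qc monicE lead_coefC => /eqP ->.
  by move: qf; rewrite q_eq1 rmorph1 hornerC => /eqP; rewrite oner_eq0.
move: qf; set m := (size q).-1 in m_gt0 *; rewrite (@horner_coef_wide _ m.+1); last first.
  by apply: leq_trans (size_poly _ _) _; rewrite /m; case: size.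
move=> /(congr1 (fun p : {poly A} => p`_(j * m))); rewrite coef0 coef_sum => qf.
exists m, (fun i => (rees_val q`_(m - i))`_(j * i)); split=> //.
  move=> i /andP[i_gt0 le_im]; rewrite ideal_expM mulnC.
  exact: rees_valP.
have coefE k : (k <= m)%N ->
    ((map_poly (@rees_val I) q)`_k * (f *: 'X^j) ^+ k)`_(j * m) =
    (rees_val q`_k)`_(j * (m - k)) * f ^+ k.
  move=> le_km; rewrite coef_map exprZn -exprM -scalerAr coefZ coefMXn.
  by rewrite ltn_mul2l [(m < k)%N]ltnNge le_km andbF -mulnBr mulrC.
rewrite -[RHS]qf big_ord_recr /= coefE // subnn muln0.
have -> : q`_m = 1 by move: q_monic; rewrite monicE => /eqP.
rewrite rmorph1 coef1 mul1r addrC; congr (_ + _).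
rewrite big_add1 big_nat_rev /= big_mkord; apply: eq_bigr => -[k lt_km] _ /=.
rewrite add0n coefE ?(ltnW lt_km) // -subSn // subSS subKn //; exact: ltnW.
Qed.

Lemma rees_ic_subring I : subring_closed (rees_ic_pred I).
Proof.
split=> [|p q|p q].
- apply/asboolP => j; apply/integral_closure_integralOver; rewrite coef1.
  case: j => [|j]; last by rewrite scale0r; exact: integral0.
  by rewrite scale1r; exact: integral1.
- move=> /asboolP Ip /asboolP Iq; apply/asboolP => j.
  apply/integral_closure_integralOver; rewrite coefB scalerBl.
  by apply: integral_sub; apply/integral_closure_integralOver.
- move=> /asboolP Ip /asboolP Iq; apply/asboolP => j.
  apply/integral_closure_integralOver; rewrite coefM scaler_suml.
  apply: (big_ind (integralOver _)); [exact: integral0|exact: integral_add|].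
  move=> i _; rewrite -[X in 'X^X](subnKC (ltnSE (ltn_ord i))) exprD.
  rewrite -scalerA scalerAr scalerAl.
  by apply: integral_mul; apply/integral_closure_integralOver.
Qed.

HB.instance Definition _ I :=
  GRing.isSubringClosed.Build {poly A} (rees_ic_pred I) (rees_ic_subring I).

(* The direct sum of the t^j times the integral closure of I^j. *)
Record rees_ic I :=
  ReesIc { rees_ic_poly : {poly A}; _ : rees_ic_poly \in rees_ic_pred I }.

HB.instance Definition _ I := [isSub for @rees_ic_poly I].
HB.instance Definition _ I := [Choice of rees_ic I by <:].
HB.instance Definition _ I := [SubChoice_isSubComNzRing of rees_ic I by <:].

Lemma polyC_rees_ic I (f : A) : f%:P \in rees_ic_pred I.
Proof.
apply/asboolP => -[|j]; apply/integral_closure_integralOver; rewrite coefC /=.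
  have If : f%:P \in rees_pred I.
    apply/asboolP => -[//|j]; rewrite coefC.
    exact: ideal0 (ideal_exp_ideal I j.+1).
  rewrite expr0 alg_polyC; exact: (integral_id _ (Rees If)).
by rewrite scale0r; exact: integral0.
Qed.

Definition to_rees_ic I (f : A) : rees_ic I := ReesIc (polyC_rees_ic I f).

(* The extension of I to the integral closure of the Rees ring. *)
Definition rees_ic_ext I : set (rees_ic I) :=
  ideal_gen [set to_rees_ic I f | f in I].

End ReesAlgebras.

Arguments to_rees_ic {A} I f.
Arguments rees_ic_ext {A} I _.

Section ReesValuations.
Variables (R : realType) (A : comNzRingType).

(* Rees valuations take the value +oo exactly at 0. *)
Definition rees_valuations (I : ideal A) : set (A -> \bar R) :=
  [set v | exists (Q : spec (rees_ic I)) (w : loc Q -> \bar R),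
    [/\ minimal_primes (rees_ic_ext I) Q, dvr_valuation w &
        v = fun f => w (to_loc Q (to_rees_ic I f))]].

Definition val_ideal (v : A -> \bar R) (I : ideal A) : \bar R :=
  ereal_inf [set v f | f in I].

(* Behrend's formula for Spec (A / I) with I zero-dimensional: the minimal
   primes of gr I then lie over closed points, where the sign and the local Euler
   obstruction are 1.  If Spec (A / I) has a unique closed point, this is the
   value of the Behrend function there. *)
Definition behrend_nu (I : ideal A) : \bar R :=
  \esum_(P in minimal_primes [set 0 : gr I]) ring_length R (loc P).

End ReesValuations.

Arguments rees_valuations R {A} I _.

Definition monomial_ideal (k : comNzRingType) (n : nat)
    (I : set {mpoly k[n]}) : Prop :=
  exists S : set 'X_{1..n}, I = ideal_gen [set 'X_[m] | m in S].

Definition zero_dimensional_ideal (R : realType) (A : comPzRingType)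
    (I : ideal A) : Prop := krull_dim R (quot_ring I) = 0%E.

(* Main.v *)
Require Import Defs.
From HB Require Import structures.
From mathcomp Require Import all_boot all_order all_algebra generic_quotient.
From mathcomp Require Import complex mpoly ring lra zify.
From mathcomp Require Import boolp classical_sets reals.
From mathcomp Require Import constructive_ereal ereal esum.

Set Implicit Arguments.
Unset Strict Implicit.
Unset Printing Implicit Defensive.

Import Order.TTheory GRing.Theory Num.Theory.
Local Open Scope classical_set_scope.
Local Open Scope ring_scope.

(** Both sides are equal to the sum, over the facets v of the Newton polyhedron of I
    whose hyperplane l y = M misses the origin, of the number M = v.2.

    The Rees ring R[It] and its integral closure are spanned by monomials X^a t^j,
    and a facet gives the monomial X^a t^j the value l a - M j, which is nonnegative
    on both rings. The elements all of whose monomials have positive value form a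
    prime ideal, the center of v. By Farkas' lemma, each prime containing the
    extension of I contains a center (center_below): otherwise some X^a in I^(j+1)
    would give an element X^a t^j that is a product of elements X^b t outside the
    prime. So the centers are the minimal primes of the associated graded ring,
    pulled back to the Rees ring, and also those of the extension of I to the
    integral closure (minimal_primes_centers).

    At a center, the integral closure localizes to a discrete valuation ring, since
    up to units each monomial is a power of one of value 1 (center_valuation). Its
    valuation of f in R is the least weight l a of a monomial of f, and the least
    value on I is M, attained at the exponents on the facet.

    At a center, the Rees ring itself need not be normal, because powers of I need
    not be integrally closed in three variables. But for n <= 3 the lattice points of
    a facet, which are all exponents of I because I is integrally closed, generate
    the lattice of the cone over the facet (lattice_generation): an empty lattice
    simplex of dimension at most 2 is unimodular. Hence monomials of equal value
    differ by units, and the localization behaves like the ring of a numerical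
    monoid V, the monoid of values. The ideal I becomes principal there, generated
    by an element of value M, and the length of the quotient is the number of
    elements of V outside M + V. There is one for each residue class modulo M, so
    the length is M (length_at_center). *)

(** * Farkas' lemma *)

Section Farkas.
Variables (F : realFieldType) (U : lmodType F) (T : eqType).
Implicit Types (al : T -> U -> F) (ga : U -> F).

Definition linear_fct ga := forall a x y, ga (a *: x + y) = a * ga x + ga y.

(** The proof, due to Bartl, is by induction on the list of constraints. If the
    first constraint al j cannot be dropped, then al j and ga are positive at some x0
    that satisfies the other constraints; projecting along x0 onto the kernel of
    al j reduces to these. *)
Lemma farkas al ga (s : seq T) :
  uniq s -> (forall i, linear_fct (al i)) -> linear_fct ga ->
  (forall x, (forall i, i \in s -> al i x <= 0) -> ga x <= 0) ->
  exists2 la : T -> F, forall i, 0 <= la i &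
    forall x, ga x = \sum_(i <- s) la i * al i x.
Proof.
have lin0 f : linear_fct f -> f 0 = 0.
  by move=> fL; have := fL (-1) 0 0; rewrite scaler0 addr0 mulN1r addNr.
elim: s al ga => [|j s IH] al ga.
  move=> _ _ gaL ga_le0; exists (fun=> 0) => // x; rewrite big_nil.
  apply: le_anti; rewrite ga_le0 //=.
  have : ga (- x) <= 0 by apply: ga_le0 => i; rewrite in_nil.
  by rewrite -[- x]addr0 -scaleN1r gaL lin0 // addr0 mulN1r oppr_le0.
move=> /= /andP[js us] alL gaL ga_le0.
have [[x0 [al_x0 ga_x0]]|nx0] :=
    pselect (exists x0, (forall i, i \in s -> al i x0 <= 0) /\ 0 < ga x0); last first.
  have [|la la_ge0 laE] := IH al ga us alL gaL.
    by move=> x al_x; rewrite leNgt; apply/negP => ga_x; apply: nx0; exists x.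
  exists (fun i => if i == j then 0 else la i) => [i|x]; first by case: ifP.
  rewrite big_cons eqxx mul0r add0r laE; apply: eq_big_seq => i si.
  by case: eqP => // eij; rewrite -eij si in js.
have be_x0 : 0 < al j x0.
  rewrite ltNge; apply/negP => be_x0; have := ga_le0 x0.
  rewrite leNgt ga_x0 => /(_ _)/negP; apply => // i.
  by rewrite inE => /orP[/eqP -> //|]; exact: al_x0.
(* pr is the projection along x0 onto the kernel of al j *)
pose be x := al j x / al j x0.
pose pr x := - be x *: x0 + x.
pose al' i x := al i (pr x); pose ga' x := ga (pr x).
have prL a x y : pr (a *: x + y) = a *: pr x + pr y.
  rewrite /pr /be alL scalerDr addrACA scalerA -scalerDl; congr (_ *: _ + _).
  by field; rewrite gt_eqF.
have [|||la la_ge0 laE] := IH al' ga' us.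
- by move=> i a x y; rewrite /al' prL alL.
- by move=> a x y; rewrite /ga' prL gaL.
- move=> x al_x; apply: ga_le0 => i; rewrite inE => /orP[/eqP ->|]; last exact: al_x.
  by rewrite /pr alL /be mulNr divfK ?gt_eqF // addNr.
exists (fun i => if i == j then (ga x0 - \sum_(i <- s) la i * al i x0) / al j x0
                 else la i) => [i|x].
  case: ifP => // _; apply: divr_ge0; last exact: ltW.
  rewrite subr_ge0; apply: le_trans (ltW ga_x0).
  by rewrite big_seq; apply: sumr_le0 => k sk; rewrite mulr_ge0_le0 ?al_x0.
rewrite big_cons eqxx.
transitivity ((ga x0 - \sum_(i <- s) la i * al i x0) / al j x0 * al j x +
  \sum_(i <- s) la i * al i x); last first.
  congr (_ + _); apply: eq_big_seq => i si.
  by case: eqP => // eij; rewrite -eij si in js.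
have := laE x; rewrite /ga' /pr gaL => e; rewrite -[LHS](addKr (- be x * ga x0)) e.
have -> : \sum_(i <- s) la i * al' i x =
  \sum_(i <- s) la i * al i x - be x * \sum_(i <- s) la i * al i x0.
  rewrite mulr_sumr -sumrB; apply: eq_bigr => i _.
  by rewrite /al' /pr alL; ring.
rewrite /be; field; by rewrite gt_eqF.
Qed.

End Farkas.

(** * Weights and facets of Newton polyhedra *)

Lemma common_denominator (T : eqType) (s : seq T) (la : T -> rat) :
  (forall i, 0 <= la i) ->
  exists2 K, (0 < K)%N & exists c : T -> nat, {in s, forall i, K%:R * la i = (c i)%:R}.
Proof.
move=> la_ge0; suff [K K_gt0 Kla] : exists2 K, (0 < K)%N &
    {in s, forall i, (K%:R : rat) * la i \is a Num.nat}.
  by exists K => //; exists (fun i => Num.truncn (K%:R * la i)) => i /Kla /truncnK ->.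
elim: s => [|j s [K K_gt0 Kla]]; first by exists 1%N.
exists (K * `|denq (la j)|)%N; first by rewrite muln_gt0 K_gt0 absz_gt0 denq_neq0.
have dE : (`|denq (la j)|%N)%:R = (denq (la j))%:~R :> rat.
  by rewrite pmulrn; congr (_%:~R); rewrite gez0_abs ?denq_ge0.
move=> i; rewrite inE natrM dE => /orP[/eqP ->|/Kla laN].
  have -> : K%:R * (denq (la j))%:~R * la j = K%:R * (numq (la j))%:~R.
    by rewrite numqE; ring.
  apply: rpredM; first exact: rpred_nat.
  have : 0 <= numq (la j) by rewrite numq_ge0.
  by case: (numq _) => // m _; exact: rpred_nat.
by rewrite mulrAC; apply: rpredM => //; rewrite -dE; exact: rpred_nat.
Qed.

Section Weights.
Variable n : nat.
Implicit Types (l : 'I_n -> nat) (a b m : 'X_{1..n}) (E F : set 'X_{1..n}).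

Definition wt l a : nat := (\sum_i l i * a i)%N.

Lemma wtD l a b : wt l (a + b)%MM = (wt l a + wt l b)%N.
Proof. by rewrite -big_split; apply: eq_bigr => i _; rewrite mnmDE mulnDr. Qed.

Lemma wt0 l : wt l 0%MM = 0%N.
Proof. by rewrite /wt big1 // => i _; rewrite mnm0E muln0. Qed.

Lemma wtMn l a k : wt l (a *+ k)%MM = (k * wt l a)%N.
Proof. by elim: k => [|k IH]; rewrite ?mulm0n ?wt0 // mulmS wtD IH mulSn. Qed.

Lemma wtU l i : wt l U_(i)%MM = l i.
Proof.
rewrite /wt (bigD1 i) //= mnm1E eqxx muln1 big1 ?addn0 // => j ji.
by rewrite mnm1E eq_sym (negPf ji) muln0.
Qed.

Lemma wt_sum l (T : Type) (r : seq T) (P : pred T) (f : T -> 'X_{1..n}) :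
  wt l (\sum_(x <- r | P x) f x)%MM = (\sum_(x <- r | P x) wt l (f x))%N.
Proof. exact: (big_morph _ (wtD l) (wt0 l)). Qed.

Lemma leq_wt l a i : (0 < l i)%N -> (a i <= wt l a)%N.
Proof.
by move=> li; rewrite /wt (bigD1 i) //=; apply: leq_trans (leq_addr _ _); rewrite leq_pmull.
Qed.

Lemma mdeg_box a N : (forall i, a i <= N)%N -> (mdeg a < (n * N).+1)%N.
Proof.
move=> aN; rewrite ltnS mdegE; apply: leq_trans (leq_sum _ (fun i _ => aN i)) _.
by rewrite sum_nat_const card_ord.
Qed.

Definition dotq (d : 'I_n -> rat) a : rat := \sum_i d i * (a i)%:R.

Definition spanning F := forall d, (forall a, F a -> dotq d a = 0) -> forall i, d i = 0.

Definition tight E (v : {ffun 'I_n -> nat} * nat) : set 'X_{1..n} :=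
  [set a | E a /\ wt v.1 a = v.2].

(** The facets of the Newton polyhedron of E whose supporting hyperplane
    wt v.1 = v.2 misses the origin: the third condition says that the entries of
    v.1 and v.2 have no common divisor, and the last one that the face cut out by
    the hyperplane has dimension n - 1. *)
Definition is_facet E (v : {ffun 'I_n -> nat} * nat) :=
  [/\ (0 < v.2)%N, forall a, E a -> (v.2 <= wt v.1 a)%N,
      exists c, wt v.1 c = 1 %[mod v.2] & spanning (tight E v)].

(** The least positive residue attained by wt l divides all attained residues, by
    Euclidean division; these include the weights of the variables and M. *)
Lemma gcd_weights l M : (0 < M)%N -> exists h, [/\ (0 < h)%N, (h %| M)%N,
  forall i, (h %| l i)%N & exists c, wt l c = h %[mod M]].
Proof.
move=> M_gt0; pose P h := (0 < h)%N && `[< exists c, wt l c = h %[mod M] >].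
have exP : exists h, P h.
  exists M; rewrite /P M_gt0; apply/asboolP; exists 0%MM.
  by rewrite wt0 modnn mod0n.
case: (ex_minnP exP) => h /andP[h_gt0 /asboolP[c wc]] h_min.
have dvd x c' : wt l c' = x %[mod M] -> (h %| x)%N.
  move=> wc'; rewrite /dvdn eqn0Ngt; apply/negP => r_gt0.
  suff : P (x %% h)%N by move=> /h_min; rewrite leqNgt ltn_pmod.
  rewrite /P r_gt0; apply/asboolP; exists (c' + c *+ (x %/ h * M.-1))%MM.
  have -> : (x %% h = (x %/ h * h) * M + x %% h %[mod M])%N by rewrite modnMDl.
  have -> : ((x %/ h * h) * M + x %% h = x + x %/ h * M.-1 * h)%N.
    by rewrite {3}(divn_eq x h) addnAC -{1}(prednK M_gt0) mulnS mulnAC.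
  by rewrite wtD wtMn -modnDm wc' -modnMmr wc modnMmr modnDm.
exists h; split=> //; last by exists c.
  by apply: (dvd _ 0%MM); rewrite wt0 modnn mod0n.
by move=> i; apply: (dvd _ U_(i)%MM); rewrite wtU.
Qed.

(** The tight exponents span, so they determine the hyperplane, hence v up to
    scaling; primitivity removes the scaling. *)
Lemma tight_inj E v v' : (0 < n)%N -> is_facet E v -> is_facet E v' ->
  tight E v `<=` tight E v' -> v = v'.
Proof.
case: v v' => [l M] [l' M'] n_gt0 [/= M_gt0 _ [c wc] sp] [/= M'_gt0 _ [c' wc'] _] sub.
have eqll' i : (M' * l i = M * l' i)%N.
  pose d i : rat := M'%:R * (l i)%:R - M%:R * (l' i)%:R.
  have := sp d _ i; rewrite /d => /(_ _)/eqP; rewrite subr_eq0 -!natrM eqr_nat.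
  move=> h; apply/eqP/h => a Fa; have [/= _ wa] := Fa; have [/= _ wa'] := sub _ Fa.
  transitivity (M'%:R * (wt l a)%:R - M%:R * (wt l' a)%:R : rat); last first.
    by rewrite wa wa' mulrC subrr.
  rewrite /wt !natr_sum !mulr_sumr -sumrB; apply: eq_bigr => j _.
  by rewrite !natrM; ring.
have eqw a : (M' * wt l a = M * wt l' a)%N.
  rewrite /wt !big_distrr /=; apply: eq_bigr => i _; by rewrite mulnA eqll' mulnA.
have dvd1 : (M %| M')%N.
  by rewrite /dvdn -[M' in X in X == _]muln1 -modnMmr -wc modnMmr eqw modnMr.
have dvd2 : (M' %| M)%N.
  by rewrite /dvdn -[M in X in X == _]muln1 -modnMmr -wc' modnMmr -eqw modnMr.
have eM : M = M' by apply/eqP; rewrite eqn_dvd dvd1.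
subst M'; congr (_, _); apply/ffunP => i; apply/eqP.
by rewrite -(eqn_pmul2l M_gt0) eqll'.
Qed.

End Weights.

(** * Existence of facets *)

Section FacetExists.
Variables (n N : nat) (E : set 'X_{1..n}).
Hypothesis N_gt0 : (0 < N)%N.
Hypothesis EU : forall i, E (U_(i) *+ N)%MM.
Local Notation BX := 'X_{1..n < (n * N).+1}.

Lemma dotqD d (a b : 'X_{1..n}) : dotq d (a + b)%MM = dotq d a + dotq d b.
Proof. by rewrite -big_split; apply: eq_bigr => i _; rewrite mnmDE natrD mulrDr. Qed.

Lemma dotqU d (i : 'I_n) k : dotq d (U_(i) *+ k)%MM = k%:R * d i.
Proof.
rewrite /dotq (bigD1 i) //= mulmnE mnm1E eqxx mul1n big1 ?addr0 1?mulrC // => j ji.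
by rewrite mulmnE mnm1E eq_sym (negPf ji) mul0n mulr0.
Qed.

Lemma boxU (i : 'I_n) : (mdeg (U_(i) *+ N)%MM < (n * N).+1)%N.
Proof.
apply: mdeg_box => j; rewrite mulmnE mnm1E.
by case: eqP; rewrite ?mul1n ?mul0n.
Qed.

(** The pure powers in E bound the exponents that matter, so that the dual
    polyhedron of E is cut out by finitely many inequalities. *)
Lemma box_generates a : E a -> exists2 m : BX, E m & (m <= a)%MM.
Proof.
move=> Ea; have [le_aN|] := pselect (forall i, (a i <= N)%N).
  by exists (BMultinom (mdeg_box le_aN)) => //; exact: lepm_refl.
move=> /existsNP[i /negP]; rewrite -ltnNge => lt_Na.
exists (BMultinom (boxU i)); first exact: EU.
apply/mnm_lepP => j; rewrite /= mulmnE mnm1E.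
by case: eqP => [<-|]; rewrite ?mul1n ?mul0n // ltnW.
Qed.

Definition feasible d := forall a, E a -> 1 <= dotq d a.

Lemma feasible_box d : (forall m : BX, E m -> 1 <= dotq d m) -> feasible d.
Proof.
move=> dm; have d_ge0 i : 0 <= d i.
  have := dm (BMultinom (boxU i)) (EU i); rewrite /= dotqU.
  move=> /(le_trans ler01); rewrite pmulr_rge0 // ltr0n //.
move=> a /box_generates[m Em /submK <-]; rewrite dotqD.
apply: le_trans (dm m Em) _; rewrite lerDr.
by apply: sumr_ge0 => i _; rewrite mulr_ge0 // ler0n.
Qed.

Section Separation.
Variable T : set 'X_{1..n}.
Hypothesis TE : T `<=` E.
(* the elements of T are minimal in E, hence lie in the box *)
Hypothesis Tmin : forall a b, T a -> E b -> (b <= a)%MM -> b = a.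
Hypothesis no_certificate : forall s t : seq 'X_{1..n},
  (forall a, a \in s -> E a) -> (forall a, a \in t -> T a) ->
  (\sum_(a <- s) a = \sum_(a <- t) a)%MM -> (size s <= size t)%N.

Local Notation J := (BX * bool)%type.
Local Notation V := ('rV[rat]_n * rat^o)%type.

(** By Farkas' lemma in the variables (d, t), with constraints dotq d a >= t for a
    in E and dotq d a <= t for a in T, either a solution with t > 0 exists, or t is
    a nonnegative combination of the forms t - dotq d a, for a in E, and dotq d a - t,
    for a in T. Multiplying by a common denominator then gives two lists with the
    same sum, and the one from E is longer. *)
Lemma separation : exists2 d, feasible d & forall a, T a -> dotq d a = 1.
Proof.
pose sg (j : J) : rat := if j.2 then 1 else -1.
pose al (j : J) (x : V) : rat := sg j * (x.2 - dotq (x.1 0) j.1).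
pose s := [seq j : J <- enum {: J} | if j.2 then `[< E j.1 >] else `[< T j.1 >]].
have us : uniq s by rewrite filter_uniq ?enum_uniq.
have alL j : linear_fct (F := rat) (U := (V : lmodType rat)) (al j).
  move=> a x y; rewrite /al /=.
  have -> : dotq ((a *: x + y).1 0) j.1 = a * dotq (x.1 0) j.1 + dotq (y.1 0) j.1.
    by rewrite /dotq mulr_sumr -big_split; apply: eq_bigr => i _; rewrite !mxE /=; ring.
  change (sg j * (a * x.2 + y.2 - (a * dotq (x.1 0) j.1 + dotq (y.1 0) j.1)) =
    a * (sg j * (x.2 - dotq (x.1 0) j.1)) + sg j * (y.2 - dotq (y.1 0) j.1) :> rat).
  by move: (x.2 : rat) (y.2 : rat) => x2 y2; ring.
have gaL : linear_fct (F := rat) (U := (V : lmodType rat)) (fun x : V => x.2 : rat) by [].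
have [[x [x_le x_gt]]|nx] :=
    pselect (exists x, (forall j, j \in s -> al j x <= 0) /\ 0 < (x : V).2).
  pose d i := x.1 0 i / x.2.
  have dE a : dotq d a = dotq (x.1 0) a / x.2.
    by rewrite /dotq mulr_suml; apply: eq_bigr => i _; rewrite /d mulrAC.
  have fd : feasible d.
    apply: feasible_box => m Em; rewrite dE ler_pdivlMr // mul1r.
    have /x_le : (m, true) \in s by rewrite mem_filter mem_enum /= andbT; apply/asboolP.
    by rewrite /al /sg /= mul1r subr_le0.
  exists d => // a Ta; apply: le_anti; rewrite fd ?andbT; last exact: TE.
  have [m Em le_ma] := box_generates (TE Ta).
  have /= eam := Tmin Ta Em le_ma; rewrite -eam dE ler_pdivrMr // mul1r.
  have /x_le : (m, false) \in s.
    by rewrite mem_filter mem_enum /= andbT; apply/asboolP; rewrite eam.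
  by rewrite /al /sg /= mulN1r oppr_le0 subr_ge0.
have [|la la_ge0 laE] := farkas us alL gaL.
  by move=> x x_le; rewrite leNgt; apply/negP => x_gt; apply: nx; exists x.
have [K K_gt0 [c cE]] := common_denominator s la_ge0.
pose part b := [seq j : J <- s | j.2 == b].
pose comb b := flatten [seq nseq (c j) (bmnm j.1) | j : J <- part b].
have size_comb b : size (comb b) = (\sum_(j <- s | j.2 == b) c j)%N.
  by rewrite size_flatten sumnE /shape !big_map big_filter;
    apply: eq_bigr => j _; rewrite size_nseq.
have sum_comb b i : (\sum_(a <- comb b) a)%MM i = (\sum_(j <- s | j.2 == b) c j * (bmnm j.1) i)%N.
  rewrite mnm_sumE big_flatten big_map /= big_filter; apply: eq_bigr => j _.
  by rewrite big_nseq iter_addn_0 mulnC.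
have split_sum f : \sum_(j <- s) K%:R * la j * (sg j * f j) =
    \sum_(j <- s | j.2 == true) (c j)%:R * f j -
    \sum_(j <- s | j.2 == false) (c j)%:R * f j.
  rewrite (bigID (fun j : J => j.2 == true)) /= -sumrN; congr (_ + _).
    rewrite big_seq_cond [RHS]big_seq_cond; apply: eq_bigr => j /andP[js /eqP j2].
    by rewrite cE // /sg j2 mul1r.
  rewrite big_seq_cond [RHS]big_seq_cond; apply: eq_big => j; first by case: j.2.
  by move=> /andP[js /negPf]; rewrite eqb_id /sg => ->; rewrite cE //; ring.
have eqsum : (\sum_(a <- comb true) a = \sum_(a <- comb false) a)%MM.
  apply/mnmP => i; rewrite !sum_comb; apply/eqP; rewrite -(eqr_nat rat) -subr_eq0.
  rewrite !natr_sum; under eq_bigr do rewrite natrM.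
  under [X in _ - X]eq_bigr do rewrite natrM.
  rewrite -(split_sum (fun j => ((bmnm j.1) i)%:R)).
  have := laE (delta_mx 0 i, 0); rewrite /= => /(congr1 (fun x => - K%:R * x)).
  rewrite mulr0 mulr_sumr => e; rewrite {2}e; apply/eqP/eq_bigr => j _.
  rewrite /al /=; have -> : dotq ((delta_mx 0 i : 'rV[rat]_n) 0) j.1 = (j.1 i)%:R.
    rewrite /dotq (bigD1 i) //= mxE !eqxx mul1r big1 ?addr0 // => k ki.
    by rewrite mxE (negPf ki) andbF mul0r.
  by ring.
have eqsize : (size (comb true) = size (comb false) + K)%N.
  rewrite !size_comb; apply/eqP; rewrite -(eqr_nat rat) natrD addrC -subr_eq !natr_sum.
  have := split_sum (fun=> 1); under [X in _ = X - _]eq_bigr do rewrite mulr1.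
  under [X in _ = _ - X]eq_bigr do rewrite mulr1.
  move=> <-; apply/eqP.
  have := laE (0, 1); rewrite /= => /(congr1 (fun x => K%:R * x)).
  rewrite mulr1 mulr_sumr => e; rewrite [RHS]e; apply: eq_bigr => j _.
  rewrite /al /=; have -> : dotq ((0 : 'rV[rat]_n) 0) j.1 = 0.
    by rewrite /dotq big1 // => k _; rewrite mxE mul0r.
  by rewrite subr0 !mulrA.
have mem_comb b a : a \in comb b -> exists2 j : J, j \in s & j.2 = b /\ a = j.1.
  move=> /flattenP[_ /mapP[j + ->]]; rewrite mem_filter => /andP[/eqP jb js].
  by move=> /nseqP[-> _]; exists j.
have := no_certificate _ _ eqsum; rewrite eqsize leqNgt -[X in (X < _)%N]addn0 ltn_add2l K_gt0.
suff h : (forall a, a \in comb true -> E a) /\ (forall a, a \in comb false -> T a).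
  by case: h => h1 h2 /(_ h1 h2).
split=> a /mem_comb[[m b]]; rewrite mem_filter /= => /andP[+ _] [eb ->].
  by rewrite eb => /asboolP.
by rewrite eb => /asboolP.
Qed.

Definition tight_set (X : {set BX}) d :=
  feasible d /\ forall m, m \in X -> E m /\ dotq d m = 1.

(** Moving from d in the direction e keeps X tight. Since e decreases some pure
    power, it decreases some constraint; the first one to become tight while
    moving is the required m. *)
Lemma extend_tight X d e i : tight_set X d -> (forall m : BX, m \in X -> dotq e m = 0) ->
  e i < 0 -> exists (m : BX) d', m \notin X /\ tight_set (m |: X) d'.
Proof.
move=> [fd dX] eX ei.
pose Y := [pred m : BX | `[< E m >] && (dotq e m < 0)].
pose step (m : BX) := (dotq d m - 1) / - dotq e m.
have Yi : Y (BMultinom (boxU i)).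
  by rewrite /Y /= dotqU pmulr_rlt0 ?ltr0n // ei andbT; apply/asboolP.
case: (arg_minP step Yi) => m /andP[/asboolP Em em] m_min.
have m_gt : 0 < - dotq e m by rewrite oppr_gt0.
have step_ge0 : 0 <= step m by apply: divr_ge0; [rewrite subr_ge0 fd | exact: ltW].
pose d' i := d i + step m * e i.
have d'E a : dotq d' a = dotq d a + step m * dotq e a.
  by rewrite /dotq mulr_sumr -big_split; apply: eq_bigr => k _; rewrite /d' mulrDl mulrA.
have d'm : dotq d' m = 1.
  by rewrite d'E /step; field; rewrite lt_eqF.
exists m, d'; split.
  by apply/negP => /eX em0; rewrite em0 ltxx in em.
split=> [|m']; last first.
  by rewrite in_setU1 => /orP[/eqP -> //|m'X]; rewrite d'E eX // mulr0 addr0; exact: dX.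
apply: feasible_box => a Ea; rewrite d'E.
have [e_ge0|e_lt0] := leP 0 (dotq e a).
  by apply: le_trans (fd _ Ea) _; rewrite lerDl mulr_ge0.
have /m_min : Y a by rewrite /Y /= e_lt0 andbT; apply/asboolP.
by rewrite /step ler_pdivlMr ?oppr_gt0 // -/(step m) => h; move: h; lra.
Qed.

(** Facets are the vertices of the dual polyhedron of E. A feasible point with a
    largest possible set of tight constraints containing T is a vertex, for
    otherwise it could be moved in one of two opposite directions until a further
    constraint is tight. *)
Lemma facet_exists : exists2 v, is_facet E v & T `<=` tight E v.
Proof.
have [d0 fd0 d0T] := separation.
pose XT : {set BX} := finset (fun m : BX => `[< T m >]).
pose P (X : {set BX}) := (XT \subset X) && `[< exists d, tight_set X d >].
have PT : P XT.
  rewrite /P subxx; apply/asboolP; exists d0; split=> // m.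
  by rewrite inE => /asboolP Tm; split; [exact: TE | exact: d0T].
case: (arg_maxnP (fun X : {set BX} => #|X|) PT) => X /andP[/fintype.subsetP sX /asboolP[d [fd dX]]] X_max.
have maxX (m : BX) d' : m \notin X -> ~ tight_set (m |: X) d'.
  move=> mX tX; suff : (#|m |: X| <= #|X|)%N by rewrite cardsU1 mX add1n ltnn.
  apply: X_max; apply/andP; split; last by apply/asboolP; exists d'.
  by apply/fintype.subsetP => x /sX xX; rewrite in_setU1 xX orbT.
have d_ge0 i : 0 <= d i.
  by have := fd _ (EU i); rewrite dotqU => /(le_trans ler01); rewrite pmulr_rge0 // ltr0n.
pose P' K := (0 < K)%N && `[< forall i, K%:R * d i \is a Num.nat >].
have exP' : exists K, P' K.
  have [K K_gt0 [c cE]] := common_denominator (enum 'I_n) d_ge0.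
  exists K; rewrite /P' K_gt0; apply/asboolP => i.
  by rewrite cE ?mem_enum // rpred_nat.
(* clearing denominators with the least multiplier makes the hyperplane primitive *)
case: (ex_minnP exP') => M /andP[M_gt0 /asboolP dM] M_min.
pose l : {ffun 'I_n -> nat} := [ffun i => Num.truncn (M%:R * d i)].
have lE i : (l i)%:R = M%:R * d i by rewrite ffunE truncnK.
have wE a : (wt l a)%:R = M%:R * dotq d a :> rat.
  rewrite /wt /dotq natr_sum mulr_sumr; apply: eq_bigr => i _.
  by rewrite natrM lE mulrA.
have tightE a : E a -> dotq d a = 1 -> tight E (l, M) a.
  move=> Ea da; split=> //=; apply/eqP; rewrite -(eqr_nat rat) wE da mulr1 //.
exists (l, M); last first.
  move=> a Ta; have Ea := TE Ta; apply: tightE => //.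
  have [m Em le_ma] := box_generates Ea; have /= ema := Tmin Ta Em le_ma.
  by have [] := dX m; rewrite ?ema //; apply: sX; rewrite inE; apply/asboolP; rewrite ema.
split=> //=.
- by move=> a /fd da; rewrite -(ler_nat rat) wE ler_peMr ?ler0n.
- have [h [h_gt0 hM hl [c wc]]] := gcd_weights l M_gt0; exists c; rewrite wc.
  have : P' (M %/ h)%N.
    rewrite /P' divn_gt0 // dvdn_leq //=; apply/asboolP => i.
    have -> : (M %/ h)%:R * d i = (l i %/ h)%:R.
      apply: (mulfI (x := h%:R)); first by rewrite pnatr_eq0 -lt0n.
      by rewrite mulrA -!natrM mulnC divnK // [X in _ = X%:R]mulnC divnK // lE.
    exact: rpred_nat.
  move=> /M_min; rewrite leq_divRL // => le_M.
  suff -> : h = 1%N by [].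
  apply/eqP; rewrite eqn_leq h_gt0 andbT -(leq_pmul2l M_gt0) muln1 //.
- move=> e eF i; apply/eqP; rewrite eq_le; apply/andP.
  have eX (m : BX) : m \in X -> dotq e m = 0.
    by move=> mX; apply: eF; have [Em dm] := dX m mX; exact: tightE.
  split; rewrite leNgt; apply/negP => ei; last first.
    by have [m [d' [mX tX]]] := extend_tight (conj fd dX) eX ei; exact: maxX mX tX.
  have [|m mX||m [d' [mX tX]]] := @extend_tight X d (fun i => - e i) i.
  - by [].
  - rewrite /dotq; under eq_bigr do rewrite mulNr.
    by rewrite sumrN -/(dotq e m) eX // oppr0.
  - by rewrite oppr_lt0.
  - exact: maxX mX tX.
Qed.

End Separation.
End FacetExists.

(** * Lattice points of a facet *)

(** Closure under convex combinations of n points, with denominators cleared. *)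
Definition lattice_convex n (E : set 'X_{1..n}) := forall z (p : 'I_n -> 'X_{1..n}) (k : 'I_n -> nat),
  (forall i, E (p i)) -> (0 < \sum_i k i)%N ->
  (z *+ (\sum_i k i) = \sum_i p i *+ k i)%MM -> E z.

Section Lattice.
Variables (n N : nat) (E : set 'X_{1..n}) (v : {ffun 'I_n -> nat} * nat).
Hypothesis EU : forall i, E (U_(i) *+ N)%MM.
Hypothesis v_facet : is_facet E v.
Local Notation l := v.1.
Local Notation M := v.2.

Lemma facet_gt0 i : (0 < l i)%N.
Proof.
have [M_gt0 /(_ _ (EU i)) + _ _] := v_facet.
by rewrite wtMn wtU => /(leq_trans M_gt0); rewrite muln_gt0 => /andP[].
Qed.

Definition expmx (p : 'I_n -> 'X_{1..n}) : 'M[rat]_n := \matrix_(i, j) (p i j)%:R.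

Lemma det_expmx_int p : exists d : nat, `|\det (expmx p)| = d%:R.
Proof.
exists `|\det (\matrix_(i, j) (p i j)%:Z : 'M[int]_n)|%N.
have -> : expmx p = map_mx intr (\matrix_(i, j) (p i j)%:Z : 'M[int]_n).
  by apply/matrixP => i j; rewrite !mxE.
by rewrite det_map_mx -intr_norm -abszE.
Qed.

Lemma tight_basis : exists p, (forall i, tight E v (p i)) /\ \det (expmx p) != 0.
Proof.
have [_ _ _ spE] := v_facet.
pose T : finType := {m : 'X_{1..n < (n * M).+1} | `[< tight E v m >]}.
pose A : 'M[rat]_(#|T|, n) := \matrix_(i, j) ((val (enum_val i : T) : 'X_{1..n}) j)%:R.
have fA : row_full A.
  rewrite -cokermx_eq0; apply/eqP/matrixP => i j; rewrite [RHS]mxE.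
  apply: (spE (fun i => cokermx A i j)) => a Fa.
  have lt_a : (mdeg a < (n * M).+1)%N.
    by apply: mdeg_box => k; have [_ <-] := Fa; exact: leq_wt (facet_gt0 k).
  have Ta : `[< tight E v (BMultinom lt_a) >] by apply/asboolP.
  have /matrixP/(_ (enum_rank (exist _ (BMultinom lt_a) Ta : T)) j) := mulmx_coker A.
  rewrite !mxE => <-; apply: eq_bigr => k _.
  by rewrite [A _ _]mxE enum_rankK /= mulrC.
pose p i : 'X_{1..n} := val (enum_val (fullrankfun fA i) : T).
exists p; split=> [i|]; first by apply/asboolP; exact: (valP (enum_val (fullrankfun fA i))).
have := fullrowsub_unit fA; rewrite unitmxE unitfE; congr (\det _ != 0).
by apply/matrixP => i j; rewrite !mxE.
Qed.

Hypothesis E_convex : lattice_convex E.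

(** A lattice point in the convex hull of tight exponents is in E by convexity,
    and its weight is an average of equal weights. *)
Lemma tight_convex (z : 'X_{1..n}) (p : 'I_n -> 'X_{1..n}) (g : 'I_n -> rat) :
  (forall i, tight E v (p i)) ->
  (forall i, 0 <= g i) -> \sum_i g i = 1 ->
  (forall j, (z j)%:R = \sum_i g i * (p i j)%:R) -> tight E v z.
Proof.
move=> Fp g_ge0 g1 zE; have [K K_gt0 [k kE]] := common_denominator (enum 'I_n) g_ge0.
have {}kE i : K%:R * g i = (k i)%:R by rewrite kE ?mem_enum.
have sumk : (\sum_i k i = K)%N.
  apply/eqP; rewrite -(eqr_nat rat) natr_sum; under eq_bigr do rewrite -kE.
  by rewrite -mulr_sumr g1 mulr1.
have zK : (z *+ (\sum_i k i) = \sum_i p i *+ k i)%MM.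
  apply/mnmP => j; rewrite mulmnE mnm_sumE sumk; apply/eqP.
  rewrite -(eqr_nat rat) natrM natr_sum zE mulr_suml; apply/eqP/eq_bigr => i _.
  by rewrite mulmnE natrM -kE; ring.
split; first by apply: E_convex zK; [move=> i; case: (Fp i) | rewrite sumk].
apply/eqP; rewrite -(eqn_pmul2l K_gt0) -{1}sumk -wtMn zK wt_sum -sumk big_distrl /=.
by apply/eqP/eq_bigr => i _; rewrite wtMn; case: (Fp i) => _ ->.
Qed.

(** The new matrix is the product of the old one with the identity matrix whose
    i-th row is replaced by the barycentric coordinates g of z. *)
Lemma det_replace (p : 'I_n -> 'X_{1..n}) i (g : 'I_n -> rat) (z : 'X_{1..n}) :
  (forall j, (z j)%:R = \sum_i g i * (p i j)%:R) ->
  \det (expmx (fun k => if k == i then z else p k)) = g i * \det (expmx p).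
Proof.
move=> zE; pose G : 'M[rat]_n := \matrix_(a, b) if a == i then g b else (a == b)%:R.
have -> : expmx (fun k => if k == i then z else p k) = G *m expmx p.
  apply/matrixP => a j; rewrite !mxE; case: eqP => [->|/eqP ai].
    by rewrite zE; apply: eq_bigr => b _; rewrite !mxE eqxx.
  rewrite (bigD1 a) //= !mxE (negPf ai) eqxx mul1r big1 ?addr0 // => b ba.
  by rewrite !mxE (negPf ai) eq_sym (negPf ba) mul0r.
rewrite det_mulmx; congr (_ * _).
rewrite (expand_det_col G i) (bigD1 i) //= mxE eqxx big1 ?addr0 => [|b bi]; last first.
  by rewrite mxE (negPf bi) mul0r.
rewrite /cofactor -signr_odd oddD addbb expr0 mul1r.
suff -> : row' i (col' i G) = 1%:M by rewrite det1 mulr1.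
apply/matrixP => a b; rewrite !mxE eq_sym (negPf (neq_lift _ _)).
by rewrite (inj_eq (@lift_inj _ i)).
Qed.

(** The barycentric coordinates g have sum 1, so a coordinate >= 1 means that the
    lattice point z is a vertex. *)
Definition empty_simplex (p : 'I_n -> 'X_{1..n}) := forall g (z : 'X_{1..n}),
  (forall i, 0 <= g i) -> \sum_i g i = 1 ->
  (forall j, (z j)%:R = \sum_i g i * (p i j)%:R :> rat) ->
  forall i, g i = 0 \/ 1 <= g i.

(** A simplex of least volume is empty: a lattice point with a barycentric
    coordinate strictly between 0 and 1 could replace a vertex and would decrease
    the volume. *)
Lemma empty_tight_basis : exists p,
  [/\ forall i, tight E v (p i), \det (expmx p) != 0 & empty_simplex p].
Proof.
pose P d := (0 < d)%N && `[< exists p, (forall i, tight E v (p i)) /\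
  `|\det (expmx p)| = d%:R >].
have exP : exists d, P d.
  have [p [Fp dp]] := tight_basis; have [d dE] := det_expmx_int p.
  exists d; apply/andP; split; last by apply/asboolP; exists p.
  by rewrite lt0n; apply/eqP => d0; move: dE; rewrite d0 => /eqP; rewrite normr_eq0 (negPf dp).
case: (ex_minnP exP) => d /andP[d_gt0 /asboolP[p [Fp dE]]] d_min.
have dp : \det (expmx p) != 0 by rewrite -normr_eq0 dE pnatr_eq0 -lt0n.
exists p; split=> // g z g_ge0 g1 zE i.
have [->|gi] := eqVneq (g i) 0; [by left|right].
have Fz := tight_convex Fp g_ge0 g1 zE.
have [d' d'E] := det_expmx_int (fun k => if k == i then z else p k).
have := d'E; rewrite (det_replace i zE) normrM dE (ger0_norm (g_ge0 i)) => d'g.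
suff : P d' by move=> /d_min; rewrite -(ler_nat rat) -d'g -[X in X <= _]mul1r ler_pM2r ?ltr0n.
apply/andP; split.
  by rewrite -(ltr_nat rat) -d'g mulr_gt0 ?ltr0n // lt0r gi g_ge0.
apply/asboolP; exists (fun k => if k == i then z else p k); split=> // k.
by case: eqP.
Qed.

Hypothesis n_le3 : (0 < n <= 3)%N.

(** This is where the dimension matters. The fractional parts f of the coordinates
    of the lattice vector u are again the coordinates of a lattice vector, and their
    sum is an integer less than n <= 3. If the sum is 1,
    this point lies in the simplex. If it is 2, then n = 3 and the numbers 1 - f
    have sum 1 and give a lattice point in the simplex. Emptiness excludes both,
    so f = 0. From n = 4 on, empty simplices need not be unimodular. *)
Lemma empty_simplex_unimodular p (u : 'rV[rat]_n) : (forall i, tight E v (p i)) ->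
  \det (expmx p) != 0 -> empty_simplex p -> (forall j, u 0 j \is a Num.int) ->
  (\sum_j (l j)%:R * u 0 j) / M%:R \is a Num.int ->
  forall i, (u *m invmx (expmx p)) 0 i \is a Num.int.
Proof.
move=> Fp dp emp u_int wu.
have [M_gt0 _ _ _] := v_facet.
have M_neq0 : M%:R != 0 :> rat by rewrite pnatr_eq0 -lt0n.
have Dunit : expmx p \in unitmx by rewrite unitmxE unitfE.
set c := u *m invmx (expmx p).
have cE j : u 0 j = \sum_i c 0 i * (p i j)%:R.
  have <- : c *m expmx p = u by rewrite /c mulmxKV.
  by rewrite mxE; apply: eq_bigr => i _; rewrite [expmx p _ _]mxE.
have sumc : \sum_i c 0 i \is a Num.int.
  suff e : (\sum_j (l j)%:R * u 0 j) / M%:R = \sum_i c 0 i by rewrite -e.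
  apply: (mulIf M_neq0); rewrite divfK //; under eq_bigr do rewrite cE mulr_sumr.
  rewrite exchange_big mulr_suml; apply: eq_bigr => i _.
  have [_ <-] := Fp i; rewrite /wt natr_sum mulr_sumr.
  by apply: eq_bigr => j _; rewrite natrM; ring.
pose f i := c 0 i - (Num.floor (c 0 i))%:~R.
have f_ge0 i : 0 <= f i by rewrite subr_ge0 floor_le.
have f_lt1 i : f i < 1.
  by have := floorD1_gt (c 0 i); rewrite intrD ltrBlDr addrC.
suff f0 i : f i = 0.
  by move=> i; rewrite intrEfloor eq_sym -subr_eq0; apply/eqP; exact: f0.
have lat (g : 'I_n -> rat) : (forall i, 0 <= g i) -> (forall j, \sum_i g i * (p i j)%:R \is a Num.int) ->
    \sum_i g i = 1 -> forall i, g i = 0 \/ 1 <= g i.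
  move=> g_ge0 g_int g1.
  have gN j : \sum_i g i * (p i j)%:R \is a Num.nat.
    by rewrite -intrEge0 // sumr_ge0 // => k _; rewrite mulr_ge0 ?ler0n.
  apply: (emp g [multinom Num.truncn (\sum_i g i * (p i j)%:R) | j < n] g_ge0 g1) => j.
  by rewrite mnmE truncnK.
have f_lat j : \sum_i f i * (p i j)%:R \is a Num.int.
  have -> : \sum_i f i * (p i j)%:R = u 0 j - \sum_i (Num.floor (c 0 i))%:~R * (p i j)%:R.
    by rewrite cE -sumrB; apply: eq_bigr => k _; rewrite mulrBl.
  by apply: rpredB => //; apply: rpred_sum => k _; apply: rpredM; rewrite ?rpred_nat ?intr_int.
have /natrP[t tE] : \sum_i f i \is a Num.nat.
  rewrite -intrEge0 ?sumr_ge0 // sumrB; apply: rpredB => //.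
  by apply: rpred_sum => k _; rewrite intr_int.
have f_case : (t = 0 \/ t = 1 \/ (t = 2 /\ n = 3))%N.
  have : (t < n)%N.
    rewrite -(ltr_nat rat) -tE -[n in ltRHS]card_ord -sumr_const.
    apply: ltr_sum => //; apply/hasP; exists i => //; exact: mem_index_enum.
  by case/andP: n_le3; lia.
have sum0 : t = 0%N -> f i = 0.
  move=> t0; move/eqP: tE; rewrite t0 psumr_eq0 // => /allP/(_ i).
  by rewrite mem_index_enum => /(_ isT)/implyP/(_ isT)/eqP.
case: f_case => [//|[t1|[t2 n3]]].
  have [|//|] := lat f f_ge0 f_lat _ i; first by rewrite tE t1.
  by rewrite leNgt f_lt1.
have [|||f1|] := lat (fun i => 1 - f i) _ _ _ i.
- by move=> k; rewrite subr_ge0 ltW.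
- move=> j; under eq_bigr do rewrite mulrBl mul1r.
  by rewrite sumrB rpredB // rpred_sum // => k _; rewrite rpred_nat.
- by rewrite sumrB tE t2 sumr_const card_ord n3; ring.
- by have := f_lt1 i; rewrite -subr_gt0 f1 ltxx.
by rewrite lerBrDl addrC -lerBrDl subrr => f_le0; apply: le_anti; rewrite f_le0 f_ge0.
Qed.

(** An empty simplex of tight exponents is unimodular, so its vertices, put at level
    1, generate the group of all pairs (a, j) with wt l a = M * j. Membership of a
    difference in this group is stated without negative coefficients. *)
Lemma lattice_generation : exists p, (forall i, tight E v (p i)) /\
  forall (a a' : 'X_{1..n}) j j', (wt l a + M * j' = wt l a' + M * j)%N ->
  exists k k' : 'I_n -> nat,
    (a + \sum_i p i *+ k i = a' + \sum_i p i *+ k' i)%MM /\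
    (j + \sum_i k i = j' + \sum_i k' i)%N.
Proof.
have [p [Fp dp emp]] := empty_tight_basis; exists p; split=> // a a' j j' waa'.
have [M_gt0 _ _ _] := v_facet.
have M_neq0 : M%:R != 0 :> rat by rewrite pnatr_eq0 -lt0n.
pose u : 'rV[rat]_n := \row_j ((a j)%:R - (a' j)%:R).
have wu : \sum_j (l j)%:R * u 0 j = M%:R * (j%:R - j'%:R).
  move/eqP: waa'; rewrite -(eqr_nat rat) !natrD !natrM => /eqP waa'.
  transitivity ((wt l a)%:R - (wt l a')%:R : rat); last by lra.
  rewrite /wt !natr_sum -sumrB; apply: eq_bigr => k _.
  by rewrite mxE !natrM mulrBr.
have Dunit : expmx p \in unitmx by rewrite unitmxE unitfE.
set c := u *m invmx (expmx p).
have c_int i : c 0 i \is a Num.int.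
  apply: empty_simplex_unimodular => // [k|].
    by rewrite mxE rpredB // rpred_nat.
  by rewrite wu mulrAC divff // mul1r rpredB // rpred_nat.
have cE k : u 0 k = \sum_i c 0 i * (p i k)%:R.
  have <- : c *m expmx p = u by rewrite /c mulmxKV.
  by rewrite mxE; apply: eq_bigr => i _; rewrite [expmx p _ _]mxE.
have sumc : \sum_i c 0 i = j%:R - j'%:R.
  apply: (mulfI M_neq0); rewrite -wu; under [RHS]eq_bigr do rewrite cE mulr_sumr.
  rewrite exchange_big mulr_sumr; apply: eq_bigr => i _.
  have [_ <-] := Fp i; rewrite /wt natr_sum mulr_suml.
  by apply: eq_bigr => k _; rewrite natrM; ring.
pose k i := if c 0 i <= 0 then absz (Num.floor (c 0 i)) else 0%N.
pose k' i := if c 0 i <= 0 then 0%N else absz (Num.floor (c 0 i)).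
have kk' i : c 0 i = (k' i)%:R - (k i)%:R.
  have normc : (absz (Num.floor (c 0 i)))%:R = `|c 0 i|.
    by rewrite -[X in _ = `|X|](floorK (c_int i)) -intr_norm -abszE.
  rewrite /k' /k; case: lerP => [c_le0|c_gt0]; rewrite normc ?subr0.
    by rewrite ler0_norm // sub0r opprK.
  by rewrite gtr0_norm.
exists k, k'; split.
  apply/mnmP => h; rewrite !mnmDE !mnm_sumE; apply/eqP; rewrite -(eqr_nat rat) !natrD.
  rewrite -subr_eq0 opprD addrACA; have := cE h; rewrite mxE => ->.
  rewrite !natr_sum -sumrB -big_split big1 //= => i _.
  by rewrite kk' !mulmnE !natrM; ring.
apply/eqP; rewrite -(eqr_nat rat) !natrD -subr_eq0 opprD addrACA -sumc.
by rewrite !natr_sum -sumrB -big_split big1 //= => i _; rewrite kk'; ring.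
Qed.

End Lattice.

(** * Gaps of a numerical monoid *)

Section Apery.
Variables (M : nat) (V : nat -> Prop).
Hypothesis M_gt0 : (0 < M)%N.
Hypothesis V_add : forall h, V h -> V (h + M)%N.
Hypothesis V_residue : forall r, exists2 h, V h & h = r %[mod M].

Definition apery h := V h /\ ~ exists2 g, V g & h = (g + M)%N.

(** In each residue class modulo M, the Apery set consists of the least element
    of V. *)
Lemma apery_card : exists (H : nat) (T : {set 'I_H}),
  [/\ #|T| = M, forall h : 'I_H, h \in T <-> apery h & forall h, apery h -> (h < H)%N].
Proof.
have minV r : exists h, [/\ V h, h = r %[mod M] & forall h', V h' -> h' = r %[mod M] -> (h <= h')%N].
  pose P h := `[< V h /\ h = r %[mod M] >].
  have exP : exists h, P h by have [h Vh e] := V_residue r; exists h; apply/asboolP.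
  case: (ex_minnP exP) => h /asboolP[Vh e] h_min; exists h; split=> // h' Vh' e'.
  by apply: h_min; apply/asboolP.
have [m mP] := choice minV.
have V_addM h q : V h -> V (h + q * M)%N.
  by move=> Vh; elim: q => [|q IH]; rewrite ?addn0 // mulSnr addnA; exact: V_add.
have aperyE h : apery h <-> h = m (h %% M)%N.
  have [Vm em m_min] := mP (h %% M)%N; rewrite modn_mod in em m_min.
  split=> [[Vh nh]|e].
    apply/eqP; rewrite eqn_leq m_min // andbT leqNgt; apply/negP => lt_mh.
    apply: nh; exists (h - M)%N.
      have /eqP := em; rewrite eq_sym eqn_mod_dvd ?(ltnW lt_mh) // => /dvdnP[q eq].
      have q_gt0 : (0 < q)%N by case: q eq => // /eqP; rewrite mul0n subn_eq0 leqNgt lt_mh.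
      have -> : (h - M = m (h %% M) + q.-1 * M)%N.
        by move: eq; case: q q_gt0 => //= q _; rewrite mulSn; lia.
      exact: V_addM.
    rewrite subnK //.
    have /eqP := em; rewrite eq_sym eqn_mod_dvd ?(ltnW lt_mh) // => /dvdn_leq.
    by rewrite subn_gt0 lt_mh => /(_ isT) /leq_trans; apply; exact: leq_subr.
  split; first by rewrite e.
  move=> [g Vg eg]; have : (h <= g)%N by rewrite {1}e; apply: m_min => //; rewrite eg modnDr.
  by rewrite eg -{2}[g]addn0 leq_add2l leqNgt M_gt0.
have mE r : apery (m r).
  by apply/aperyE; have [V1 e1 m1] := mP r; have [V2 e2 m2] := mP (m r %% M)%N;
    apply/eqP; rewrite eqn_leq m1 ?m2 // ?e2 ?modn_mod // e1 modn_mod.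
pose H := (\max_(r < M) m r).+1.
have ltH h : apery h -> (h < H)%N.
  move=> /aperyE ->; have lt_r : (h %% M < M)%N by rewrite ltn_pmod.
  by rewrite ltnS (leq_bigmax_cond (Ordinal lt_r) isT (F := fun r : 'I_M => m r)).
pose t (r : 'I_M) : 'I_H := Ordinal (ltH _ (mE r)).
exists H, (t @: [set: 'I_M]%SET)%SET; split=> //.
- rewrite card_imset ?cardsT ?card_ord // => r r' /(congr1 val) /= e.
  have [_ e1 _] := mP r; have [_ e2 _] := mP r'; apply/val_inj => /=.
  by rewrite -[RHS](modn_small (ltn_ord r')) -e2 -e e1 modn_small.
- move=> h; split=> [/imsetP[r _ ->]|ah]; first exact: mE.
  have lt_r : (h %% M < M)%N by rewrite ltn_pmod.
  apply/imsetP; exists (Ordinal lt_r) => //; apply/val_inj => /=.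
  exact/aperyE.
Qed.
End Apery.

(** * Quotients and localizations *)

Section QuotientsAndLocalizations.
Local Open Scope quotient_scope.

Lemma spec_eq (A : comPzRingType) (P Q : spec A) : (P : set A) = Q -> P = Q.
Proof. by case: P Q => P pP [Q pQ] /= e; subst Q; congr Spec; exact: Prop_irrelevance. Qed.

Section QuotientMap.
Variables (A : comPzRingType) (J : ideal A).

Definition qpi (a : A) : quot_ring J := \pi a.

Lemma qpiD a b : qpi (a + b) = qpi a + qpi b.
Proof. exact: pi_quot_add. Qed.

Lemma qpiM a b : qpi (a * b) = qpi a * qpi b.
Proof. exact: pi_quot_mul. Qed.

Lemma qpi0 : qpi 0 = 0.
Proof. by rewrite /qpi piE. Qed.

Lemma qpi1 : qpi 1 = 1.
Proof. by rewrite /qpi piE. Qed.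

Lemma qpi_surj x : exists a, x = qpi a.
Proof. by exists (repr x); rewrite /qpi reprK. Qed.

Lemma qpi_eq a b : qpi a = qpi b <-> ideal_set J (a - b).
Proof.
split=> [/eqmodP/asboolP //|Jab]; by apply/eqmodP/asboolP.
Qed.

Lemma qpi_eq0 a : qpi a = 0 <-> ideal_set J a.
Proof. by rewrite -qpi0 qpi_eq subr0. Qed.

Lemma pull_prime (Q : spec (quot_ring J)) : is_prime_ideal [set a | prime_set Q (qpi a)].
Proof.
have [iQ Q1 QM] := Defs.primeP Q; split=> /=; first split=> /=.
- by rewrite qpi0; exact: ideal0.
- by move=> a b Qa Qb; rewrite qpiD; exact: idealD.
- by move=> a b Qb; rewrite qpiM; exact: idealM.
- by rewrite qpi1.
- by move=> a b; rewrite qpiM; exact: QM.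
Qed.

Definition pull (Q : spec (quot_ring J)) : spec A := Spec (pull_prime Q).

Lemma pull_sub Q : J `<=` pull Q.
Proof.
by move=> a /qpi_eq0 /= e; rewrite /= e; have [iQ _ _] := Defs.primeP Q; exact: ideal0.
Qed.

Lemma pull_le Q Q' : pull Q `<=` pull Q' <-> Q `<=` Q'.
Proof.
split=> [QQ' x|QQ' a /QQ' //].
by have [a ->] := qpi_surj x; exact: QQ'.
Qed.

Lemma push_exists (P : spec A) : J `<=` P -> exists Q, pull Q = P.
Proof.
move=> JP; have [iP P1 PM] := Defs.primeP P.
pose S : set (quot_ring J) := [set x | exists2 a, prime_set P a & x = qpi a].
have SE a : S (qpi a) -> prime_set P a.
  move=> [b Pb /qpi_eq/JP Pab]; rewrite -[a](subrK b); exact: idealD.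
have pS : is_prime_ideal S.
  split; first split.
  - by exists 0; [exact: ideal0 | rewrite qpi0].
  - by move=> _ _ [a Pa ->] [b Pb ->]; exists (a + b); [exact: idealD | rewrite qpiD].
  - move=> x _ [b Pb ->]; have [a ->] := qpi_surj x.
    by exists (a * b); [exact: idealM | rewrite qpiM].
  - by rewrite -qpi1 => /SE.
  - move=> x y; have [a ->] := qpi_surj x; have [b ->] := qpi_surj y.
    by rewrite -qpiM => /SE /PM[Pa|Pb]; [left; exists a | right; exists b].
exists (Spec pS); apply: spec_eq; apply/seteqP; split=> a /=; first exact: SE.
by move=> Pa; exists a.
Qed.

Lemma pull_inj Q Q' : pull Q = pull Q' -> Q = Q'.
Proof.
by move=> e; apply: spec_eq; apply/seteqP; split; apply/pull_le; rewrite e.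
Qed.

Lemma pull_minimal Q : minimal_primes [set 0] Q <-> minimal_primes J (pull Q).
Proof.
have zQ Q' : [set 0] `<=` (Q' : spec (quot_ring J)).
  by move=> _ ->; have [iQ _ _] := Defs.primeP Q'; exact: ideal0.
split=> [[_ minQ]|[_ minQ]]; split=> //; first exact: pull_sub.
  move=> P /push_exists[Q' <-] /pull_le QQ'; apply/pull_le.
  exact: minQ (zQ Q') QQ'.
by move=> Q' _ QQ'; apply/pull_le/minQ; [exact: pull_sub | exact/pull_le].
Qed.

End QuotientMap.

(** th exhibits L as the localization of A / J at the image of the prime P. This
    hides the construction of L by equivalence classes. *)
Record is_localization (A L : comPzRingType) (th : A -> L) (J P : set A) : Prop := {
  locD : {morph th : a b / a + b};
  locM : {morph th : a b / a * b};
  loc1 : th 1 = 1;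
  loc_eq0 : forall a, th a = 0 <-> exists2 u, ~ P u & J (u * a);
  loc_surj : forall x, exists a u, ~ P u /\ th u * x = th a;
  loc_unit : forall u, ~ P u -> exists x, x * th u = 1 }.

Lemma to_loc_localization (A : comPzRingType) (P : spec A) :
  is_localization (@to_loc A P) [set 0] P.
Proof.
have toE a : to_loc P a = \pi_(loc P) (frac_of P a) by rewrite /to_loc; unlock.
have eqE a b : to_loc P a = to_loc P b <-> exists2 u, ~ prime_set P u & u * a = u * b.
  rewrite !toE; split => [/eqmodP/asboolP|[u Pu e]].
    by move=> [u Pu] /=; rewrite !mulr1 => e; exists u.
  by apply/eqmodP/asboolP; exists u => //=; rewrite !mulr1.
have ME (x y : fracs P) : \pi_(loc P) x * \pi_(loc P) y = \pi_(loc P) (frac_mul x y).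
  by rewrite pi_loc_mul.
have DE (x y : fracs P) : \pi_(loc P) x + \pi_(loc P) y = \pi_(loc P) (frac_add x y).
  by rewrite pi_loc_add.
have piE1 (x y : fracs P) : Defs.num x * Defs.den y = Defs.num y * Defs.den x -> \pi_(loc P) x = \pi_(loc P) y.
  by move=> e; apply/eqmodP/asboolP; exists 1; [exact: notin_prime1 | rewrite e].
split=> //.
- by move=> a b; rewrite !toE DE; apply: piE1; rewrite /= !mulr1.
- by move=> a b; rewrite !toE ME; apply: piE1; rewrite /= !mulr1.
- move=> a; split=> [/eqE[u Pu e]|[u Pu e]].
    by exists u => //=; rewrite e mulr0.
  by apply/eqE; exists u => //; rewrite e mulr0.
- elim/quotW => -[a u Pu]; exists a, u; split=> //.
  by rewrite !toE ME; apply: piE1 => /=; ring.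
- move=> u Pu; exists (\pi_(loc P) (Frac 1 Pu)).
  rewrite -[RHS]/(to_loc P 1).
  by rewrite !toE ME; apply: piE1 => /=; ring.
Qed.

Lemma quot_localization (A : comPzRingType) (J : ideal A) (Q : spec (quot_ring J)) :
  is_localization (fun a => to_loc Q (qpi J a)) J (pull Q).
Proof.
have [D M o z s u] := to_loc_localization Q; split.
- by move=> a b; rewrite qpiD D.
- by move=> a b; rewrite qpiM M.
- by rewrite qpi1 o.
- move=> a; rewrite z; split=> [[x Qx /= e]|[x Qx /qpi_eq0 e]].
    have [b xb] := qpi_surj x; exists b; first by rewrite /= -xb.
    by apply/qpi_eq0; rewrite qpiM -xb.
  by exists (qpi J x) => //=; rewrite -qpiM.
- move=> x; have [a [t [Qt e]]] := s x.
  have [a' ea] := qpi_surj a; have [t' et] := qpi_surj t.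
  by exists a', t'; split; rewrite /= -?ea -?et.
- by move=> t Qt; exact: u.
Qed.

End QuotientsAndLocalizations.

(** * Lengths *)

(** In a localization at P, the length is computed from a decreasing filtration c of
    the ring by P-saturated ideals: each step of c is trivial or simple, and a
    simple step h is killed by P and generated by y h up to elements outside P. *)
Section Length.
Variables (R : realType) (A L : comPzRingType) (th : A -> L) (J P : set A).
Hypothesis thL : is_localization th J P.

Lemma loc0 : th 0 = 0.
Proof. by apply: (addrI (th 0)); rewrite -(locD thL) !addr0. Qed.

Lemma locN a : th (- a) = - th a.
Proof. by apply: (addrI (th a)); rewrite -(locD thL) !subrr loc0. Qed.

Lemma loc_idealM (I : ideal L) u x : ~ P u -> ideal_set I (th u * x) -> ideal_set I x.
Proof.
move=> /(loc_unit thL)[y e] Ix; rewrite -[x]mul1r -e -mulrA.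
exact: idealM (idealP I) _.
Qed.

Lemma loc_ideal_sub (I K : ideal L) :
  (forall a, ideal_set I (th a) -> ideal_set K (th a)) -> I `<=` K.
Proof.
move=> IK x Ix; have [a [u [Pu e]]] := loc_surj thL x; apply: (loc_idealM Pu).
by rewrite e; apply: IK; rewrite -e; apply: idealM (idealP I) _.
Qed.

Hypothesis PM : forall u v, ~ P u -> ~ P v -> ~ P (u * v).

(** Saturated ideals are contracted from the localization. *)
Lemma loc_ideal_exists (c : set A) : is_ideal c -> J `<=` c ->
  (forall u f, ~ P u -> c (u * f) -> c f) ->
  exists I : ideal L, forall f, ideal_set I (th f) <-> c f.
Proof.
move=> idc Jc cS.
have iI : is_ideal [set x | exists f u, [/\ c f, ~ P u & th u * x = th f]].
  split.
  - have [a [u [Pu e]]] := loc_surj thL 0; exists 0, u; split=> //; first exact: ideal0.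
    by rewrite mulr0 loc0.
  - move=> x y [f [u [cf Pu ef]]] [g [v [cg Pv eg]]].
    exists (v * f + u * g), (u * v); split; [|exact: PM|].
      by apply: idealD => //; apply: idealM.
    by rewrite (locD thL) !(locM thL) -ef -eg; ring.
  - move=> b x [f [u [cf Pu ef]]]; have [a [v [Pv eb]]] := loc_surj thL b.
    exists (a * f), (v * u); split; [exact: idealM | exact: PM |].
    by rewrite !(locM thL) -ef -eb; ring.
exists (Ideal iI) => f /=; split=> [[g [u [cg Pu e]]]|cf].
  have /(loc_eq0 thL)[w Pw Jw] : th (u * f - g) = 0.
    by rewrite (locD thL) locN (locM thL) e subrr.
  apply: (cS (w * u)); first exact: PM.
  have -> : w * u * f = w * (u * f - g) + w * g by ring.
  by apply: idealD => //; [exact: Jc | exact: idealM].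
have [a [u [Pu _]]] := loc_surj thL 0.
by exists (u * f), u; split=> //; [exact: idealM | rewrite (locM thL)].
Qed.

Variables (c : nat -> set A) (y : nat -> A) (H : nat) (T : {set 'I_H}).
Hypothesis c_ideal : forall h, is_ideal (c h).
Hypothesis c0 : c 0%N = setT.
Hypothesis c_decr : forall h, c h.+1 `<=` c h.
Hypothesis Jc : forall h, J `<=` c h.
Hypothesis cH : forall f, c H f -> exists2 u, ~ P u & J (u * f).
Hypothesis c_sat : forall h u f, ~ P u -> c h (u * f) -> c h f.
Hypothesis c_flat : forall h : 'I_H, h \notin T -> c h `<=` c h.+1.
Hypothesis y_in : forall h : 'I_H, h \in T -> c h (y h).
Hypothesis y_notin : forall h : 'I_H, h \in T -> ~ c h.+1 (y h).
Hypothesis y_ann : forall (h : 'I_H) p, h \in T -> P p -> c h.+1 (p * y h).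
Hypothesis y_gen : forall (h : 'I_H) f, h \in T -> c h f ->
  exists u b, ~ P u /\ c h.+1 (u * f - b * y h).

(** The steps of the filtration at which I is nonzero, as in the proof of the
    Jordan-Hoelder theorem. *)
Let jumps (I : ideal L) : {set 'I_H} := finset (fun h : 'I_H =>
  `[< exists f, [/\ ideal_set I (th f), c h f & ~ c h.+1 f] >]).

Let jumpsT I : jumps I \subset T.
Proof.
apply/fintype.subsetP => h; rewrite inE => /asboolP[f [_ cf ncf]].
by apply/negPn/negP => /c_flat/(_ f cf).
Qed.

Let jumps_sub (I K : ideal L) : I `<=` K -> jumps I \subset jumps K.
Proof.
move=> IK; apply/fintype.subsetP => h; rewrite [h \in jumps I]finset.in_set => /asboolP[f [If cf ncf]].
by rewrite finset.in_set; apply/asboolP; exists f; split=> //; exact: IK.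
Qed.

(** Let f in K be of exact step h, and g in I of the same step. Both agree up to
    units with multiples of y h, so a combination of them is in the next step and
    descending induction applies. *)
Let jumps_eq (I K : ideal L) : I `<=` K -> jumps K \subset jumps I -> K `<=` I.
Proof.
move=> IK /fintype.subsetP VKI; apply: loc_ideal_sub.
suff main d f : (d <= H)%N -> c (H - d)%N f -> ideal_set K (th f) -> ideal_set I (th f).
  by move=> f; apply: (main H f) => //; rewrite subnn c0.
elim: d f => [|d IH] f.
  rewrite subn0 => _ /cH/(loc_eq0 thL) -> _; exact: ideal0 (idealP I).
move=> lt_dH; have [ch|nch] := pselect (c (H - d)%N f); first by move=> _; apply: IH ch; exact: ltnW.
have lt_h : (H - d.+1 < H)%N by lia.
pose h := Ordinal lt_h; have hS : h.+1 = (H - d)%N by rewrite /=; lia.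
rewrite -[(H - d.+1)%N]/(val h) => cf Kf; rewrite -hS in nch.
have hT : h \in T by apply/negPn/negP => /c_flat/(_ f cf).
have : h \in jumps K by rewrite inE; apply/asboolP; exists f; split.
move=> /VKI; rewrite inE => /asboolP[g [Ig cg ncg]].
have [u [b [Pu e]]] := y_gen hT cg; have [u' [b' [Pu' e']]] := y_gen hT cf.
have Pb : ~ P b.
  move=> /(y_ann hT) cb; apply: ncg; apply: (c_sat Pu).
  by rewrite -[u * g](subrK (b * y h)); apply: idealD (c_ideal _) e cb.
apply: (loc_idealM (PM Pb Pu')); rewrite -(locM thL).
have cfg : c h.+1 (b * u' * f - b' * u * g).
  have -> : b * u' * f - b' * u * g = b * (u' * f - b' * y h) + (- b') * (u * g - b * y h).
    by ring.
  by apply: idealD (c_ideal _) _ _; apply: idealM (c_ideal _) _.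
have Ig' : ideal_set I (th (b' * u * g)) by rewrite (locM thL); apply: idealM (idealP I) _.
rewrite -[b * u' * f](subrK (b' * u * g)) (locD thL); apply: (idealD (idealP I) _ Ig').
apply: IH; first exact: ltnW.
  by rewrite -hS.
rewrite (locD thL) locN; apply: idealD (idealP K) _ _.
  by rewrite (locM thL); apply: idealM (idealP K) _.
by apply: idealN (idealP K) _; exact: IK.
Qed.

Let length_le k (I : nat -> ideal L) :
  (forall i, (i < k)%N -> I i `<` I i.+1) -> (k <= #|T|)%N.
Proof.
move=> lt_I; suff le_i i : (i <= k)%N -> (i <= #|jumps (I i)|)%N.
  by apply: leq_trans (le_i k _) (subset_leq_card (jumpsT _)).
elim: i => // i IH lt_ik; apply: leq_ltn_trans (IH (ltnW lt_ik)) _.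
have [sI nI] := lt_I i lt_ik; apply: proper_card; apply/andP; split.
  exact: jumps_sub.
by apply/negP => /(jumps_eq sI).
Qed.

(** The chain is built from the bottom of the filtration, one ideal for each
    nontrivial step. *)
Let length_ge : exists I : nat -> ideal L, forall i, (i < #|T|)%N -> I i `<` I i.+1.
Proof.
have exI h : exists I : ideal L, forall f, ideal_set I (th f) <-> c h f.
  by apply: loc_ideal_exists => //; exact: c_sat.
have [e eE] := choice exI.
suff main d : (d <= H)%N -> exists2 I : nat -> ideal L,
    forall i, (i < #|[set h in T | (H - d <= h)%N]%SET|)%N -> I i `<` I i.+1 &
    forall f, ideal_set (I #|[set h in T | (H - d <= h)%N]%SET|) (th f) <-> c (H - d)%N f.
  have [I lt_I _] := main H (leqnn _); exists I.
  suff -> : T = [set h in T | (H - H <= h)%N]%SET by [].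
  by apply/setP => h; rewrite inE subnn andbT.
elim: d => [|d IH] lt_dH.
  have -> : [set h in T | (H - 0 <= h)%N]%SET = finset.set0.
    by apply/setP => h; rewrite !inE subn0 leqNgt ltn_ord andbF.
  by rewrite cards0 subn0; exists (fun=> e H).
have [I lt_I IE] := IH (ltnW lt_dH).
have lt_h : (H - d.+1 < H)%N by lia.
pose h := Ordinal lt_h; have hS : h.+1 = (H - d)%N by rewrite /=; lia.
have [hT|hT] := boolP (h \in T); last first.
  have -> : [set k in T | (H - d.+1 <= k)%N]%SET = [set k in T | (H - d <= k)%N]%SET.
    apply/setP => k; rewrite !inE; have [kT|//] := boolP (k \in T).
    rewrite /= -hS leq_eqVlt -[(H - d.+1)%N]/(val h) eq_sym; case: eqP => //= ekh.
    by rewrite -(val_inj (ekh : val k = val h)) kT in hT.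
  exists I => // f; rewrite IE -hS -[(H - d.+1)%N]/(val h).
  by split; [exact: c_decr | exact: c_flat].
have -> : [set k in T | (H - d.+1 <= k)%N]%SET = h |: [set k in T | (H - d <= k)%N]%SET.
  apply/setP => k; rewrite !inE -hS -[(H - d.+1)%N]/(val h) leq_eqVlt eq_sym.
  by rewrite -(inj_eq val_inj) andb_orr; case: eqP => [/val_inj ->|_]; rewrite ?hT ?andbF.
rewrite cardsU1 !inE -hS ltnn andbF add1n -[(H - d.+1)%N]/(val h).
rewrite -hS in IE lt_I.
set m := #|_| in IE lt_I *.
exists (fun i => if (i <= m)%N then I i else e h); last by move=> f; rewrite ltnn eE.
move=> i; rewrite ltnS => le_im.
have /orP[/eqP ->|lt_im] : (i == m) || (i < m)%N by rewrite -leq_eqVlt.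
  rewrite leqnn ltnn; split; first by apply: loc_ideal_sub => f /IE/c_decr/eE.
  move=> /(_ (th (y h))) eI; apply: (y_notin hT); apply/IE/eI/eE; exact: y_in.
by rewrite le_im lt_im; exact: lt_I.
Qed.

Theorem ring_length_filtration : ring_length R L = (#|T|%:R)%:E.
Proof.
apply/eqP; rewrite eq_le; apply/andP; split.
  apply: ge_ereal_sup => _ [k [I /length_le le_kT] <-].
  by rewrite lee_fin ler_nat.
by apply: ereal_sup_ubound; exists #|T| => //; exact: length_ge.
Qed.

End Length.

(** * Uniqueness of the valuation of a discrete valuation ring *)

(** An element of value 0 divides 1, so both valuations have the same units. Every
    element is a unit times a power of an element p of value 1 for the first
    valuation, and normalization of the second one forces its value at p to be 1. *)
Lemma dvr_valuation_unique (R : realType) (L : comPzRingType) (w w' : L -> \bar R) :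
  dvr_valuation w -> dvr_valuation w' -> w = w'.
Proof.
move=> dw dw'.
have v1 (u : L -> \bar R) : dvr_valuation u -> u 1 = 0%E.
  move=> [u0 uN uM _ [[p up] _]].
  have [h uh] : exists h : nat, u 1 = (h%:R)%:E.
    apply: uN => e1; have /u0 : p = 0 by rewrite -[p]mul1r e1 mul0r.
    by rewrite up.
  have := uM 1 1; rewrite mul1r uh -EFinD => -[] /eqP.
  by rewrite -subr_eq0 opprD addrA subrr sub0r oppr_eq0 => /eqP ->.
have sum0 (u : L -> \bar R) x y : dvr_valuation u -> u (x * y) = 0%E -> u y = 0%E.
  move=> du; have [u0 uN uM _ _] := du.
  have [->|/eqP x0] := eqVneq x 0; first by rewrite mul0r => e; have := (u0 0).2 erefl; rewrite e.
  have [->|/eqP y0] := eqVneq y 0; first by rewrite mulr0 => e; have := (u0 0).2 erefl; rewrite e.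
  have [h eh] := uN _ x0; have [h' eh'] := uN _ y0; rewrite uM eh eh' -EFinD -natrD.
  by move=> -[] /eqP; rewrite pnatr_eq0 addn_eq0 => /andP[_ /eqP ->].
have unit0 (u u' : L -> \bar R) x : dvr_valuation u -> dvr_valuation u' -> u x = 0%E -> u' x = 0%E.
  move=> du du' ux; have [_ _ _ _ [_ dvd]] := du.
  have [|c ec] := dvd x 1; first by rewrite ux v1.
  by apply: (sum0 u' c) => //; rewrite -ec v1.
have [u0 uN uM _ [[p wp] dvd]] := dw; have [u0' uN' uM' _ [[q wq] dvd']] := dw'.
have p0 : p <> 0 by move=> /u0; rewrite wp.
have q0 : q <> 0 by move=> /u0'; rewrite wq.
have w'p : w' p = 1%E.
  have [h eh] := uN' _ p0; have [m em] := uN _ q0.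
  have h_gt0 : (0 < h)%N.
    case: h eh => // eh; have := unit0 _ _ _ dw' dw eh; rewrite wp => -[] /eqP.
    by rewrite oner_eq0.
  have m_gt0 : (0 < m)%N.
    case: m em => // em; have := unit0 _ _ _ dw dw' em; rewrite wq => -[] /eqP.
    by rewrite oner_eq0.
  have [|c ec] := dvd p q; first by rewrite wp em lee_fin ler1n.
  have c0 : c <> 0 by move=> c0; apply: q0; rewrite ec c0 mul0r.
  have [i ei] := uN' _ c0; have := uM' c p; rewrite -ec wq ei eh -EFinD -natrD.
  move=> -[] /eqP; rewrite eq_sym pnatr_eq1 => /eqP ih; rewrite (_ : h = 1%N) //; lia.
apply: funext => x; have [->|/eqP x0] := eqVneq x 0; first by rewrite (u0 0).2 // (u0' 0).2.
have [h eh] := uN _ x0; rewrite eh.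
have wX (u : L -> \bar R) m : dvr_valuation u -> u p = 1%E -> u (p ^+ m) = (m%:R)%:E.
  move=> du up; elim: m => [|m IH]; first by rewrite expr0 v1.
  by have [_ _ uM1 _ _] := du; rewrite exprS uM1 up IH -EFinD -natr1 addrC.
have [|c ec] := dvd (p ^+ h) x; first by rewrite wX // eh.
have c0 : c <> 0 by move=> c0; apply: x0; rewrite ec c0 mul0r.
have wc : w c = 0%E.
  have [i ei] := uN _ c0; move: eh; rewrite ec uM wX // ei -EFinD -natrD => -[] /eqP.
  by rewrite eqr_nat -{2}[h]add0n eqn_add2r => /eqP ->.
by rewrite ec uM' wX // (unit0 _ _ _ dw dw' wc) add0e.
Qed.

(** * Monomials in polynomials over polynomials *)

Section PolySupport.
Variables (k : fieldType) (n : nat).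
Local Notation A := {mpoly k[n]}.
Implicit Types (p q : {poly A}) (a b : 'X_{1..n}) (j : nat).

(** The coefficient of X^a t^j. *)
Definition cf p a j : k := (p`_j)@_a.
Definition mono a j : {poly A} := 'X_[a] *: 'X^j.

Lemma cfD p q a j : cf (p + q) a j = cf p a j + cf q a j.
Proof. by rewrite /cf coefD mcoeffD. Qed.

Lemma cfN p a j : cf (- p) a j = - cf p a j.
Proof. by rewrite /cf coefN mcoeffN. Qed.

Lemma cf0 a j : cf 0 a j = 0.
Proof. by rewrite /cf coef0 mcoeff0. Qed.

Lemma cf_mono a j b i : cf (mono a j) b i = ((a == b) && (j == i))%:R.
Proof.
rewrite /cf /mono coefZ coefXn eq_sym; case: eqP => _; last by rewrite mulr0 mcoeff0 andbF.
by rewrite mulr1 mcoeffX andbT.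
Qed.

Lemma cf_neq0 p : p != 0 -> exists a j, cf p a j != 0.
Proof.
move=> p0; exists (mlead (lead_coef p)), (size p).-1.
by rewrite /cf -/(lead_coef p) mleadc_eq0 lead_coef_eq0.
Qed.

Lemma cfM_neq0 p q a j : cf (p * q) a j != 0 ->
  exists a1 j1 a2 j2, [/\ a = (a1 + a2)%MM, j = (j1 + j2)%N, cf p a1 j1 != 0 & cf q a2 j2 != 0].
Proof.
rewrite /cf coefM raddf_sum => /= ne; have [i /eqP ni] : exists i : 'I_j.+1, (p`_i * q`_(j - i))@_a <> 0.
  apply: contrapT => h; move/eqP: ne; apply; apply: big1 => i _.
  by apply: contrapT => e; apply: h; exists i.
move: ni; rewrite -mcoeff_msupp => /msuppM_le /allpairsP[[a1 a2] /= [h1 h2 ->]].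
exists a1, (i : nat), a2, (j - i)%N; split; rewrite -?mcoeff_msupp //.
by rewrite subnKC // -ltnS.
Qed.

Lemma mono_sum p : p = \sum_(j < size p) \sum_(a <- msupp p`_j) (cf p a j)%:MP%:P * mono a j.
Proof.
rewrite -[LHS]coefK poly_def; apply: eq_bigr => j _.
rewrite [p`_j in LHS]mpolyE scaler_suml; apply: eq_bigr => a _.
by rewrite /mono /cf mul_polyC scalerA mul_mpolyC.
Qed.

Definition filt (Q : 'X_{1..n} -> nat -> bool) p : {poly A} :=
  \poly_(j < size p) \sum_(a <- msupp p`_j | Q a j) cf p a j *: 'X_[a].

Lemma cf_filt Q p a j : cf (filt Q p) a j = if Q a j then cf p a j else 0.
Proof.
rewrite /cf /filt coef_poly; case: ltnP => [_|le_j]; last first.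
  by rewrite nth_default // mcoeff0 if_same.
rewrite raddf_sum /=; under eq_bigr do rewrite mcoeffZ mcoeffX.
have [ap|ap] := boolP (a \in msupp p`_j); last first.
  rewrite (memN_msupp_eq0 ap) if_same big_seq_cond big1 // => b /andP[bp _].
  by case: eqP => [eba|_]; rewrite ?mulr0 //; rewrite -eba bp in ap.
rewrite big_mkcond (bigD1_seq a) ?msupp_uniq //= eqxx mulr1 big1 ?addr0 // => b ba.
by rewrite (negPf ba) mulr0 if_same.
Qed.

Section InitialForms.
Variable v : 'X_{1..n} -> nat -> int.
Hypothesis vD : forall a b i j, v (a + b)%MM (i + j) = v a i + v b j.

(** If the weight s + t arises in p * q only from the weights s in p and t in q, then
    the part of p * q of this weight is the product of the nonzero parts of p and q,
    and polynomials form a domain. *)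
Lemma weight_mul p q s t :
  (exists a i, cf p a i != 0 /\ v a i = s) -> (exists b j, cf q b j != 0 /\ v b j = t) ->
  (forall a i b j, cf p a i != 0 -> cf q b j != 0 -> v a i + v b j = s + t ->
    v a i = s /\ v b j = t) ->
  exists a j, cf (p * q) a j != 0 /\ v a j = s + t.
Proof.
move=> [a0 [i0 [pa va]]] [b0 [j0 [qb vb]]] only.
pose p1 := filt (fun a j => v a j == s) p; pose q1 := filt (fun a j => v a j == t) q.
have p1_neq0 : p1 != 0.
  by apply: contra_neq pa => e; have := cf0 a0 i0; rewrite -e cf_filt va eqxx.
have q1_neq0 : q1 != 0.
  by apply: contra_neq qb => e; have := cf0 b0 j0; rewrite -e cf_filt vb eqxx.
have p1P a i : cf p1 a i != 0 -> cf p a i != 0 /\ v a i = s.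
  by rewrite cf_filt; case: (v a i =P s) => [e h|_]; [split | rewrite eqxx].
have q1P a i : cf q1 a i != 0 -> cf q a i != 0 /\ v a i = t.
  by rewrite cf_filt; case: (v a i =P t) => [e h|_]; [split | rewrite eqxx].
have p2P a i : cf (p - p1) a i != 0 -> cf p a i != 0 /\ v a i <> s.
  by rewrite cfD cfN cf_filt; case: (v a i =P s) => [_|e]; rewrite ?subrr ?eqxx ?subr0 => h; split.
have q2P a i : cf (q - q1) a i != 0 -> cf q a i != 0 /\ v a i <> t.
  by rewrite cfD cfN cf_filt; case: (v a i =P t) => [_|e]; rewrite ?subrr ?eqxx ?subr0 => h; split.
have [a [j pq1]] := cf_neq0 (mulf_neq0 p1_neq0 q1_neq0).
have vaj : v a j = s + t.
  have [a1 [j1 [a2 [j2 [-> -> /p1P[_ e1] /q1P[_ e2]]]]]] := cfM_neq0 pq1.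
  by rewrite vD e1 e2.
exists a, j; split=> //.
have -> : p * q = p1 * q1 + (p1 * (q - q1) + (p - p1) * q) by ring.
suff [e1 e2] : cf (p1 * (q - q1)) a j = 0 /\ cf ((p - p1) * q) a j = 0.
  by rewrite !cfD e1 e2 !addr0.
split; apply/eqP/negPn/negP => /cfM_neq0[a1 [j1 [a2 [j2 [ea ej]]]]].
  move=> /p1P[pa1 _] /q2P[qa2 ne]; apply: ne.
  by have [] := only _ _ _ _ pa1 qa2; rewrite // -vD -ea -ej.
move=> /p2P[pa1 ne] qa2; apply: ne.
by have [] := only _ _ _ _ pa1 qa2; rewrite // -vD -ea -ej.
Qed.

End InitialForms.
End PolySupport.

(** * Rings spanned by monomials *)

Section PowerExponents.
Variables (n : nat) (E : set 'X_{1..n}).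
Implicit Types (a b : 'X_{1..n}) (i j : nat).

(** The exponents of the monomials in the j-th power of the monomial ideal with
    exponent set E. *)
Definition pow_exp j a := exists s : seq 'X_{1..n},
  [/\ size s = j, forall x, x \in s -> E x & (\sum_(x <- s) x <= a)%MM].

Lemma pow_exp0 a : pow_exp 0 a.
Proof. by exists [::]; split=> //; rewrite big_nil; apply/mnm_lepP => i; rewrite mnm0E. Qed.

Lemma pow_exp1 a : E a -> pow_exp 1 a.
Proof. by move=> Ea; exists [:: a]; split=> // [x /[!inE]/eqP->//|]; rewrite big_seq1 lepm_refl. Qed.

Lemma pow_expD i j a b : pow_exp i a -> pow_exp j b -> pow_exp (i + j) (a + b)%MM.
Proof.
move=> [s [<- Es /mnm_lepP le_s]] [t [<- Et /mnm_lepP le_t]]; exists (s ++ t); split.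
- by rewrite size_cat.
- by move=> x; rewrite mem_cat => /orP[/Es|/Et].
- by apply/mnm_lepP => h; rewrite big_cat /= !mnmDE leq_add.
Qed.

Lemma pow_expM j a k : pow_exp j a -> pow_exp (k * j) (a *+ k)%MM.
Proof.
move=> ja; elim: k => [|k IH]; first exact: pow_exp0.
by rewrite mulSn mulmS; exact: pow_expD.
Qed.

Lemma pow_exp_sum (T : finType) (f : T -> 'X_{1..n}) (c : T -> nat) :
  (forall x, E (f x)) -> pow_exp (\sum_i c i) (\sum_i f i *+ c i)%MM.
Proof.
move=> Ef; apply: (big_ind2 pow_exp); first exact: pow_exp0.
  by move=> ? ? ? ?; exact: pow_expD.
by move=> x _; rewrite -{1}[c x]muln1; apply/pow_expM/pow_exp1.
Qed.

Lemma pow_exp_le i j a b : (j <= i)%N -> (a <= b)%MM -> pow_exp i a -> pow_exp j b.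
Proof.
move=> le_ji le_ab [s [ss Es le_s]]; exists (take j s); split.
- by rewrite size_takel // ss.
- by move=> x /mem_take/Es.
- apply: lepm_trans le_ab; apply: lepm_trans le_s.
  by rewrite -{2}(cat_take_drop j s) big_cat lem_addr.
Qed.

Lemma pow_exp_wt l M j a : (forall b, E b -> (M <= wt l b)%N) -> pow_exp j a -> (M * j <= wt l a)%N.
Proof.
move=> EM [s [<- Es /submK <-]]; rewrite wtD; apply: leq_trans (leq_addl _ _).
elim: s Es => [|x s IH] Es; first by rewrite muln0.
rewrite big_cons wtD /= mulnS; apply: leq_add; first exact/EM/Es/mem_head.
by apply: IH => y ys; apply: Es; rewrite inE ys orbT.
Qed.

End PowerExponents.

(** The Rees ring and its integral closure are treated together, as a ring B with
    an embedding into polynomials in t whose image is spanned by the monomials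
    X^a t^j with S a j. *)
Section MonomialRing.
Variables (k : fieldType) (n : nat) (B : comNzRingType).
Local Notation A := {mpoly k[n]}.
Variables (val : {rmorphism B -> {poly A}}) (S : 'X_{1..n} -> nat -> Prop).
Hypothesis val_inj : injective val.
Hypothesis val_im : forall p, (exists b, val b = p) <-> forall a j, cf p a j != 0 -> S a j.
Implicit Types (a : 'X_{1..n}) (j : nat) (f g : B).

Lemma cf_val f a j : cf (val f) a j != 0 -> S a j.
Proof. by apply: (val_im (val f)).1; exists f. Qed.

(** The element X^a t^j of B; the value is irrelevant unless S a j holds. *)
Definition x_ a j : B := xget 0 [set b | val b = mono k a j].

Lemma val_x a j : S a j -> val (x_ a j) = mono k a j.
Proof.
move=> Saj; suff : [set b | val b = mono k a j] (x_ a j) by [].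
apply: xgetPex; apply/val_im => b i; rewrite cf_mono; case: andP; last by rewrite eqxx.
by move=> [/eqP <- /eqP <-].
Qed.

Lemma S00 : S 0%MM 0.
Proof. by apply: (@cf_val 1); rewrite rmorph1 /cf coef1 /= mcoeff1 !eqxx oner_eq0. Qed.

Lemma monoM a i b j : mono k a i * mono k b j = mono k (a + b)%MM (i + j).
Proof. by rewrite /mono -scalerAl -scalerAr scalerA mpolyXD exprD. Qed.

Lemma SD a i b j : S a i -> S b j -> S (a + b)%MM (i + j).
Proof.
move=> Sa Sb; apply: (@cf_val (x_ a i * x_ b j)).
by rewrite rmorphM !val_x // monoM cf_mono !eqxx oner_eq0.
Qed.

Lemma xM a i b j : S a i -> S b j -> x_ a i * x_ b j = x_ (a + b)%MM (i + j).
Proof. by move=> Sa Sb; apply: val_inj; rewrite rmorphM !val_x ?monoM //; exact: SD. Qed.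

Lemma x00 : x_ 0%MM 0 = 1.
Proof. by apply: val_inj; rewrite val_x ?rmorph1; [rewrite /mono mpolyX0 scale1r expr0 | exact: S00]. Qed.

Lemma SMn a j m : S a j -> S (a *+ m)%MM (m * j).
Proof. by move=> Sa; elim: m => [|m IH]; [exact: S00 | rewrite mulmS mulSn; exact: SD]. Qed.

Lemma xX a j m : S a j -> x_ a j ^+ m = x_ (a *+ m)%MM (m * j).
Proof.
move=> Sa; elim: m => [|m IH]; first by rewrite expr0 mulm0n mul0n x00.
by rewrite exprS IH xM ?mulmS ?mulSn //; exact: SMn.
Qed.

(** B contains the scalars, so its elements are combinations of their monomials
    within B. *)
Lemma ideal_of_monomials (K : set B) f : is_ideal K ->
  (forall a j, cf (val f) a j != 0 -> K (x_ a j)) -> K f.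
Proof.
move=> iK Kf; suff [g vg Kg] : exists2 g, val g = val f & K g by rewrite -(val_inj vg).
rewrite (mono_sum (val f)).
pose K' p := exists2 g, val g = p & K g; rewrite -/(K' _).
have K'D p q : K' p -> K' q -> K' (p + q).
  by move=> [b <- Kb] [c <- Kc]; exists (b + c); rewrite ?rmorphD //; exact: idealD.
have K'0 : K' 0 by exists 0; rewrite ?rmorph0 //; exact: ideal0.
apply: (big_ind K') => // j _; rewrite big_seq; apply: (big_ind K') => // a af.
have {}af : cf (val f) a j != 0 by rewrite /cf -mcoeff_msupp.
have [c cE] : exists c, val c = (cf (val f) a j)%:MP%:P.
  apply/val_im => b i; rewrite /cf coefC; case: (i =P 0%N) => [->|_]; last by rewrite mcoeff0 eqxx.
  by rewrite mcoeffC; case: (b =P 0%MM) => [->|_]; [move=> _; exact: S00 | rewrite mulr0 eqxx].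
exists (c * x_ a j); last by apply: idealM => //; exact: Kf.
by rewrite rmorphM cE val_x //; exact: cf_val af.
Qed.

Section Facets.
Variables (N : nat) (E : set 'X_{1..n}).
Hypothesis EU : forall i, E (U_(i) *+ N)%MM.
(* B lies between the Rees ring and its integral closure *)
Hypothesis S_pw : forall a j, pow_exp E j a -> S a j.
Hypothesis pow_exp_S : forall a j, S a j -> exists2 m, (0 < m)%N & pow_exp E (m * j) (a *+ m)%MM.

(** The value of X^a t^j under the valuation defined by v and extended by
    giving t the value - v.2, that is, the lattice distance of (a, j) to the cone
    over the facet. *)
Definition ht (v : {ffun 'I_n -> nat} * nat) a j : int := (wt v.1 a)%:Z - (v.2 * j)%:Z.

Lemma htD v a b i j : ht v (a + b)%MM (i + j) = ht v a i + ht v b j.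
Proof. by rewrite /ht wtD mulnDr !PoszD; ring. Qed.

Lemma S_ht v a j : is_facet E v -> S a j -> 0 <= ht v a j.
Proof.
move=> [_ EM _ _] /pow_exp_S[m m_gt0 /(pow_exp_wt EM)].
by rewrite wtMn mulnCA leq_pmul2l // subr_ge0 lez_nat.
Qed.

Lemma ht_tight v a : tight E v a -> ht v a 1 = 0.
Proof. by move=> [_ e]; rewrite /ht e muln1 subrr. Qed.

(** The center on B of the monomial valuation of v. *)
Definition center v : set B := [set f | forall a j, cf (val f) a j != 0 -> 0 < ht v a j].

Lemma center_x v a j : S a j -> center v (x_ a j) <-> 0 < ht v a j.
Proof.
move=> Sa; rewrite /center /= val_x //; split=> [|h b i].
  by apply; rewrite cf_mono !eqxx oner_eq0.
by rewrite cf_mono; case: andP => [[/eqP <- /eqP <-] //|_]; rewrite eqxx.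
Qed.

Lemma notin_center v f : is_facet E v -> ~ center v f ->
  exists a j, cf (val f) a j != 0 /\ ht v a j = 0.
Proof.
move=> vF /existsNP[a /existsNP[j /not_implyP[fa /negP h]]]; exists a, j; split=> //.
by apply: le_anti; rewrite leNgt h (S_ht vF (cf_val fa)).
Qed.

(** An element outside the center has a part of value 0, and such parts multiply. *)
Lemma center_prime v : is_facet E v -> is_prime_ideal (center v).
Proof.
move=> vF; split; first split.
- by move=> a j; rewrite rmorph0 cf0 eqxx.
- move=> f g cf_ cg a j; rewrite rmorphD cfD => ne.
  have [e|] := eqVneq (cf (val f) a j) 0; last exact: cf_.
  by apply: cg; rewrite e add0r in ne.
- move=> b f cf_ a j; rewrite rmorphM => /cfM_neq0[a1 [j1 [a2 [j2 [-> -> h1 h2]]]]].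
  by rewrite htD ltr_wpDl ?(S_ht vF (cf_val h1)) ?cf_.
- move=> /(_ 0%MM 0%N); rewrite rmorph1 /cf coef1 /= mcoeff1 !eqxx oner_eq0.
  by rewrite /ht wt0 muln0 => /(_ isT); rewrite ltxx.
- move=> f g cfg; apply: contrapT => /not_orP[/(notin_center vF) hf /(notin_center vF) hg].
  have [|a [j [ne e]]] := weight_mul (htD v) hf hg.
    move=> a i b j fa gb; have := S_ht vF (cf_val fa); have := S_ht vF (cf_val gb).
    by rewrite addr0; lia.
  by have := cfg a j; rewrite rmorphM => /(_ ne); rewrite e addr0 ltxx.
Qed.

Definition center_spec v (vF : is_facet E v) : spec B := Spec (center_prime vF).

(** The center determines which monomials X^a t have value 0. *)
Lemma center_sub_inj v v' : (0 < n)%N -> is_facet E v -> is_facet E v' ->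
  center v `<=` center v' -> v = v'.
Proof.
move=> n_gt0 vF v'F sub; apply/esym; apply: (tight_inj n_gt0 v'F vF) => a ta.
have [Ea _] := ta; split=> //; have Sa : S a 1 by exact/S_pw/pow_exp1.
have : ~ center v (x_ a 1).
  by move=> /sub/(center_x _ Sa); rewrite (ht_tight ta) ltxx.
move=> /(center_x _ Sa)/negP; rewrite -leNgt => h.
have := S_ht vF Sa; move: h; rewrite /ht muln1; lia.
Qed.

Section PrimeAboveCenter.
Hypothesis N_gt0 : (0 < N)%N.
Variable P : spec B.
Hypothesis P_pw : forall a j, pow_exp E j.+1 a -> prime_set P (x_ a j).

Let PM f g : prime_set P (f * g) -> prime_set P f \/ prime_set P g.
Proof. by have [_ _] := Defs.primeP P; apply. Qed.

Let PXn f m : prime_set P (f ^+ m) -> prime_set P f.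
Proof.
have [_ P1 _] := Defs.primeP P.
by elim: m => [/P1 //|m IH]; rewrite exprS => /PM[|/IH].
Qed.

(** A pure power of each variable is in the monomial ideal of E, hence in P at level
    0, and P is prime. *)
Let P_w w : w <> 0%MM -> prime_set P (x_ w 0).
Proof.
move=> w0; have [i wi] : exists i, (0 < w i)%N.
  apply: contrapT => h; apply: w0; apply/mnmP => i; rewrite mnm0E; apply/eqP.
  by rewrite -leqn0 leqNgt; apply/negP => wi; apply: h; exists i.
have Ui : prime_set P (x_ U_(i)%MM 0).
  apply: (@PXn _ N); rewrite xX ?muln0; last exact/S_pw/pow_exp0.
  exact/P_pw/pow_exp1.
have /submK <- : (U_(i) <= w)%MM by rewrite lep1mP -lt0n.
rewrite -[0%N]addn0 -xM; try exact/S_pw/pow_exp0.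
by apply: idealM Ui; have [] := Defs.primeP P.
Qed.

(* exponents that must become tight for the center to lie in P *)
Let T : set 'X_{1..n} := [set a | E a /\ ~ prime_set P (x_ a 1)].

(** P is prime, so a product of elements X^a t with a in E and of some X^w is
    outside P exactly if all factors are; by the previous fact this leaves only
    w = 0. *)
Let P_sum t w j : (forall a, a \in t -> E a) -> j = size t ->
  ~ prime_set P (x_ (\sum_(a <- t) a + w)%MM j) <-> w = 0%MM /\ forall a, a \in t -> T a.
Proof.
have iP : is_ideal P by have [] := Defs.primeP P.
move=> Et ->; have pwt : pow_exp E (size t) (\sum_(a <- t) a)%MM by exists t; split=> //; exact: lepm_refl.
rewrite -[size t]addn0 -xM; [|exact: S_pw|exact/S_pw/pow_exp0].
split=> [nP|[-> tT]].
  split=> [|a at_].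
    by apply: contrapT => /P_w Pw; apply: nP; exact: idealM.
  split=> [|Pa]; first exact: Et.
  apply: nP; rewrite mulrC; apply: (idealM _ iP).
  rewrite (perm_big _ (perm_to_rem at_)) big_cons (perm_size (perm_to_rem at_)) /=.
  rewrite -add1n -xM; first by rewrite mulrC; exact: idealM.
    exact/S_pw/pow_exp1/Et.
  apply: S_pw; exists (rem a t); split=> //; last exact: lepm_refl.
  by move=> y /mem_rem/Et.
rewrite x00 mulr1; elim: t Et pwt tT => [|a t IH] Et _ tT.
  by rewrite big_nil x00; have [] := Defs.primeP P.
have Et' b : b \in t -> E b by move=> bt; apply: Et; rewrite inE bt orbT.
have pwt' : pow_exp E (size t) (\sum_(b <- t) b)%MM by exists t; split=> //; exact: lepm_refl.
rewrite big_cons /= -add1n -xM; [|exact/S_pw/pow_exp1/Et/mem_head|exact: S_pw].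
move=> /PM[|]; first by have [] := tT a (mem_head _ _).
by apply: IH => // b bt; apply: tT; rewrite inE bt orbT.
Qed.

(** A certificate against a facet that is tight on T would be a monomial X^a t^j
    that is a product of elements X^b t outside P, whereas X^a is in the power j + 1
    of the ideal. So there is such a facet v. A monomial of B outside P has a power
    that is a product of elements X^b t with b in T, hence has value 0. *)
Lemma center_below : exists2 v, is_facet E v & center v `<=` P.
Proof.
have TE : T `<=` E by move=> a [].
have Tmin a b : T a -> E b -> (b <= a)%MM -> b = a.
  move=> [Ea nP] Eb /submK e; have := (@P_sum [:: b] (a - b)%MM 1 _ _).1.
  rewrite big_seq1 addmC e => /(_ _ _ nP)[||w0 _] //; first by move=> y /[!inE] /eqP ->.
  by rewrite -e w0 add0m.
have [|v vF Tv] := facet_exists N_gt0 EU TE Tmin.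
  move=> s t Es Tt est; rewrite leqNgt; apply/negP => lt_ts.
  have := (@P_sum t 0%MM (size t) _ _).2; rewrite addm0; apply=> //.
    by move=> a /Tt[].
  by apply/P_pw/(pow_exp_le lt_ts (lepm_refl _)); exists s; rewrite est; split=> //; exact: lepm_refl.
exists v => // f cf_; have iP : is_ideal P by have [] := Defs.primeP P.
apply: ideal_of_monomials => // a j fa; have Sa := cf_val fa.
apply: contrapT => nP; have := cf_ a j fa.
have [m m_gt0 [s [ss Es /submK]]] := pow_exp_S Sa; rewrite addmC => e.
have : ~ prime_set P (x_ (a *+ m)%MM (m * j)) by rewrite -xX // => /PXn.
rewrite -e => /P_sum[] // w0 sT; rewrite /ht subr_gt0 ltz_nat.
rewrite -(ltn_pmul2l m_gt0) -(wtMn _ a) -e w0 addm0 mulnCA -ss wt_sum.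
under eq_big_seq => b bs do (have [_ ->] := Tv _ (sT b bs)).
by rewrite big_const_seq count_predT iter_addn_0 ltnn.
Qed.

End PrimeAboveCenter.

(** Each prime containing J contains a center, and no center contains
    another one. *)
Theorem minimal_primes_centers (J : set B) : (0 < N)%N -> (0 < n)%N ->
  (forall P : spec B, J `<=` P -> forall a j, pow_exp E j.+1 a -> prime_set P (x_ a j)) ->
  (forall v, is_facet E v -> J `<=` center v) ->
  forall P : spec B, minimal_primes J P <-> exists2 v, is_facet E v & (P : set B) = center v.
Proof.
move=> N_gt0 n_gt0 JP Jc P; split=> [[/JP P_pw minP]|[v vF eP]].
  have [v vF cP] := center_below N_gt0 P_pw; exists v => //; apply/seteqP; split=> //.
  exact: (minP (center_spec vF) (Jc v vF) cP).
split; first by rewrite eP; exact: Jc.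
move=> Q /JP Q_pw QP; have [v' v'F cQ] := center_below N_gt0 Q_pw.
suff e : v' = v by rewrite eP -e.
by apply: (center_sub_inj n_gt0 v'F vF) => f /cQ/QP; rewrite eP.
Qed.

Section FacetLattice.
Hypothesis n_le3 : (0 < n <= 3)%N.
Hypothesis E_convex : lattice_convex E.
Variable v : {ffun 'I_n -> nat} * nat.
Hypothesis vF : is_facet E v.

(** Such monomials are units in the localization at the center. *)
Definition face b j := pow_exp E j b /\ ht v b j = 0.

Lemma face_notin b j : face b j -> ~ center v (x_ b j).
Proof. by move=> [/S_pw Sb e] /(center_x _ Sb); rewrite e ltxx. Qed.

Lemma face_mul a a' j j' : ht v a j = ht v a' j' -> exists b i b' i',
  [/\ face b i, face b' i', (a + b = a' + b')%MM & (j + i = j' + i')%N].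
Proof.
move=> e; have [p [Fp gen]] := lattice_generation EU vF E_convex n_le3.
have [|c [c' [ea ej]]] := gen a a' j j'; first by move: e; rewrite /ht; lia.
have faceP (d : 'I_n -> nat) : face (\sum_i p i *+ d i)%MM (\sum_i d i)%N.
  split; first by apply: pow_exp_sum => i; case: (Fp i).
  rewrite /ht wt_sum big_distrr /= -(_ : \sum_i wt v.1 (p i *+ d i) = \sum_i v.2 * d i)%N ?subrr //.
  by apply: eq_bigr => i _; rewrite wtMn; have [_ ->] := Fp i; rewrite mulnC.
by do 4!eexists; split; [exact: (faceP c) | exact: (faceP c') | exact: ea | exact: ej].
Qed.

Lemma x_unit_mul a a' j j' : S a j -> S a' j' -> ht v a j = ht v a' j' ->
  exists u w, [/\ ~ center v u, ~ center v w & u * x_ a j = w * x_ a' j'].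
Proof.
move=> Sa Sa' /face_mul[b [i [b' [i' [fb fb' ea ej]]]]].
exists (x_ b i), (x_ b' i'); split; try exact: face_notin.
have [[/S_pw Sb _] [/S_pw Sb' _]] := (fb, fb').
by rewrite (mulrC (x_ b i)) (mulrC (x_ b' i')) !xM // ea ej.
Qed.

Lemma tight_nonempty : exists a, tight E v a.
Proof.
have [p [Fp _]] := lattice_generation EU vF E_convex n_le3.
by have /andP[n_gt0 _] := n_le3; exists (p (Ordinal n_gt0)).
Qed.

Section AssociatedGradedRing.
(* B is the Rees ring, and B / J the associated graded ring *)
Hypothesis S_is_pw : forall a j, S a j -> pow_exp E j a.
Variable J : set B.
Hypothesis JE : forall f, J f <-> forall a j, cf (val f) a j != 0 -> pow_exp E j.+1 a.

(** The values of monomials of the Rees ring. They form a numerical monoid, which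
    need not contain 1, for the Rees ring need not be normal. *)
Definition value (h : nat) := exists a j, S a j /\ ht v a j = h%:Z.

Lemma valueD h h' : value h -> value h' -> value (h + h').
Proof.
move=> [a [j [Sa e]]] [a' [j' [Sa' e']]]; exists (a + a')%MM, (j + j')%N.
by split; [exact: SD | rewrite htD e e' PoszD].
Qed.

Lemma valueM : value v.2.
Proof.
have [a0 [Ea0 ta0]] := tight_nonempty; exists a0, 0%N.
by split; [exact/S_pw/pow_exp0 | rewrite /ht ta0 muln0 subr0].
Qed.

Lemma value_residue r : exists2 h, value h & h = r %[mod v.2].
Proof.
have [_ _ [c ec] _] := vF; exists (wt v.1 (c *+ r)%MM).
  by exists (c *+ r)%MM, 0%N; split; [exact/S_pw/pow_exp0 | rewrite /ht muln0 subr0].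
by rewrite wtMn -modnMmr ec modnMmr muln1.
Qed.

Local Notation shifted x := (exists2 g, value g & x = (g + v.2)%N%:Z).

Let shifted_add a j x : S a j -> shifted x -> shifted (ht v a j + x).
Proof.
move=> Sa [g Vg ->]; have := S_ht vF Sa; case e : (ht v a j) => [h|h] // _.
by exists (h + g)%N; [apply: valueD => //; exists a, j | lia].
Qed.

(** Locally at the center, a monomial is in J exactly if its value is in the ideal
    value + v.2. The remaining monomials are filtered by their value. *)
Definition gap_filtration (h : nat) : set B := [set f | forall a j, cf (val f) a j != 0 ->
  h%:Z <= ht v a j \/ shifted (ht v a j)].

Let gap_ideal h : is_ideal (gap_filtration h).
Proof.
split.
- by move=> a j; rewrite rmorph0 cf0 eqxx.
- move=> f g cf_ cg a j; rewrite rmorphD cfD => ne.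
  have [e|] := eqVneq (cf (val f) a j) 0; last exact: cf_.
  by apply: cg; rewrite e add0r in ne.
- move=> b f cf_ a j; rewrite rmorphM => /cfM_neq0[a1 [j1 [a2 [j2 [-> -> h1 h2]]]]].
  have S1 := cf_val h1; rewrite htD; have [le_h|sh] := cf_ _ _ h2.
    by left; have := S_ht vF S1; lia.
  by right; exact: shifted_add.
Qed.

Let gap0 : gap_filtration 0 = setT.
Proof.
by apply/seteqP; split=> // f _ a j /cf_val Sa; left; exact: S_ht.
Qed.

Let gap_decr h : gap_filtration h.+1 `<=` gap_filtration h.
Proof. by move=> f cf_ a j /cf_[le_h|]; [left; lia | right]. Qed.

Let gapJ h : J `<=` gap_filtration h.
Proof.
move=> f /JE Jf a j /Jf/S_pw Sa; right.
have := S_ht vF Sa; case e : (ht v a j.+1) => [g|g] // _.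
by exists g; [exists a, j.+1 | move: e; rewrite /ht mulnS; lia].
Qed.

Let centerM f g : ~ center v f -> ~ center v g -> ~ center v (f * g).
Proof. by have [_ _ cM] := center_prime vF; move=> nf ng /cM[]. Qed.

Let J_ideal : is_ideal J.
Proof.
split.
- by apply/JE => a j; rewrite rmorph0 cf0 eqxx.
- move=> f g /JE cf_ /JE cg; apply/JE => a j; rewrite rmorphD cfD => ne.
  have [e|] := eqVneq (cf (val f) a j) 0; last exact: cf_.
  by apply: cg; rewrite e add0r in ne.
- move=> b f /JE cf_; apply/JE => a j; rewrite rmorphM.
  move=> /cfM_neq0[a1 [j1 [a2 [j2 [-> -> h1 h2]]]]].
  by rewrite -addnS; apply: pow_expD; [exact/S_is_pw/cf_val/h1 | exact: cf_].
Qed.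

(** A monomial X^a t^j of value g + v.2 differs by units from the product of one of
    value g with X^a0, where a0 is tight. As X^a0 is in the monomial ideal of E, this
    product is in J. *)
Let gap_last H f : (forall h, apery v.2 value h -> (h < H)%N) -> gap_filtration H f ->
  exists2 u, ~ center v u & J (u * f).
Proof.
move=> ltH cHf; pose K : set B := [set f | exists2 u, ~ center v u & J (u * f)].
suff : K f by [].
have n1 : ~ center v 1 by have [] := center_prime vF.
apply: ideal_of_monomials => [|a j fa].
  split.
  - by exists 1; rewrite // mulr0; exact: ideal0.
  - move=> g h [u nu Ju] [w nw Jw]; exists (u * w); first exact: centerM.
    have -> : u * w * (g + h) = w * (u * g) + u * (w * h) by ring.
    by apply: idealD => //; exact: idealM.
  - move=> b g [u nu Ju]; exists u => //.
    have -> : u * (b * g) = b * (u * g) by ring.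
    exact: idealM.
have Sa := cf_val fa.
have [g [a' [j' [Sa' e']]] e] : shifted (ht v a j).
  have [le_H|//] := cHf a j fa; apply: contrapT => ns.
  have := S_ht vF Sa; case e : (ht v a j) => [h|h] // _.
  have /ltH : apery v.2 value h.
    by split; [exists a, j | move=> [g Vg eh]; apply: ns; exists g; rewrite // e eh].
  by move: le_H; rewrite e; lia.
have [a0 [Ea0 ta0]] := tight_nonempty.
have Sa0 : S (a0 + a')%MM j' by rewrite -[j']add0n; apply: SD => //; exact/S_pw/pow_exp0.
have [|u [w [nu nw euw]]] := x_unit_mul Sa Sa0.
  rewrite -[j' in RHS]add0n htD e' e /ht ta0 muln0 subr0; lia.
exists u => //; rewrite euw; apply: idealM => //; apply/JE => b i.
rewrite val_x // cf_mono; case: andP => [[/eqP <- /eqP <-] _|_]; last by rewrite eqxx.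
by rewrite -add1n; apply: pow_expD; [exact: pow_exp1 | exact: S_is_pw].
Qed.

(** Take the least value m < h of a monomial of f outside value + v.2. In u * f, it
    arises only from the part of u of value 0: smaller values of f are in
    value + v.2, and then so is m. *)
Let gap_saturated h u f : ~ center v u -> gap_filtration h (u * f) -> gap_filtration h f.
Proof.
move=> /(notin_center vF) hu cuf; apply: contrapT => ncf.
pose bad x := ~ (h%:Z <= x \/ shifted x).
pose P (m : nat) := `[< exists a j, [/\ cf (val f) a j != 0, ht v a j = m%:Z & bad m%:Z] >].
have exP : exists m, P m.
  move: ncf => /existsNP[a /existsNP[j /not_implyP[fa ba]]].
  have := S_ht vF (cf_val fa); case e : (ht v a j) => [m|m] // _.
  by exists m; apply/asboolP; exists a, j; rewrite -e.
case: (ex_minnP exP) => m /asboolP[a [j [fa ea bm]]] m_min.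
have [||a1 [j1 [ne e1]]] := @weight_mul _ _ _ (htD v) (val u) (val f) 0 m%:Z hu.
- by exists a, j.
- move=> a1 i1 a2 j2 ua fa2; rewrite add0r => es.
  have S1 := cf_val ua; have h1 := S_ht vF S1; have h2 := S_ht vF (cf_val fa2).
  have [le_m2|lt_2m] := leP m%:Z (ht v a2 j2); first lia.
  case e2 : (ht v a2 j2) h2 lt_2m => [m2|m2] // _ lt_2m.
  have [b2|] := pselect (bad m2%:Z).
    have : P m2 by apply/asboolP; exists a2, j2.
    by move=> /m_min; lia.
  move=> /contrapT[le_h|s2]; exfalso; apply: bm; first by left; lia.
  by right; rewrite -es e2; exact: shifted_add.
by apply: bm; have := cuf a1 j1; rewrite rmorphM e1 add0r; apply.
Qed.

(** The simple steps of the filtration correspond to the elements of the value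
    monoid outside its shift by v.2, and there are v.2 of them. *)
Theorem length_at_center (R : realType) (L : comPzRingType) (th : B -> L) :
  is_localization th J (center v) -> ring_length R L = (v.2%:R)%:E.
Proof.
move=> thL; have [M_gt0 _ _ _] := vF.
have [|H [T [cardT TE ltH]]] := apery_card M_gt0 _ value_residue.
  by move=> h Vh; apply: valueD => //; exact: valueM.
rewrite -cardT.
have xV h : exists f, value h -> exists a j, [/\ S a j, ht v a j = h%:Z & f = x_ a j].
  have [[a [j [Sa e]]]|nV] := pselect (value h); last by exists 0.
  by exists (x_ a j) => _; exists a, j.
have [y yE] := choice xV.
apply: (ring_length_filtration R thL centerM gap_ideal gap0 gap_decr gapJ
  (y := y)) => //.
- by move=> f; apply: gap_last.
- move=> h /negP hT f cf_ a j fa; have [le_h|] := cf_ a j fa; last by right.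
  have [e|ne] := eqVneq (ht v a j) h%:Z; last by left; lia.
  right; rewrite e; have Vh : value h by exists a, j; split=> //; exact: cf_val fa.
  by apply: contrapT => ns; apply/hT/TE; split=> // -[g Vg eh]; apply: ns; exists g; rewrite // eh.
- move=> h /TE[Vh _]; have [a [j [Sa e ->]]] := yE _ Vh.
  move=> b i; rewrite val_x // cf_mono; case: andP => [[/eqP <- /eqP <-] _|]; last by rewrite eqxx.
  by left; rewrite e.
- move=> h /TE[Vh nh]; have [a [j [Sa e ->]]] := yE _ Vh.
  move=> /(_ a j); rewrite val_x // cf_mono !eqxx oner_eq0 e => /(_ isT)[|[g Vg [eg]]]; first lia.
  by apply: nh; exists g.
- move=> h p /TE[Vh _] cp; have [a [j [Sa e ->]]] := yE _ Vh.
  move=> b i; rewrite rmorphM => /cfM_neq0[a1 [j1 [a2 [j2 [-> -> h1]]]]].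
  rewrite val_x // cf_mono; case: andP => [[/eqP <- /eqP <-] _|_]; last by rewrite eqxx.
  by left; rewrite htD e; have := cp _ _ h1; lia.
- move=> h f /TE[Vh _] cf_; have [a0 [j0 [S0 e0 ->]]] := yE _ Vh.
  set z := x_ a0 j0.
  pose K : set B := [set f | exists u b, ~ center v u /\ gap_filtration h.+1 (u * f - b * z)].
  suff : K f by [].
  have n1 : ~ center v 1 by have [] := center_prime vF.
  apply: ideal_of_monomials => [|a j fa].
    split.
    + by exists 1, 0; rewrite mulr0 mul0r subrr; split=> //; exact: ideal0 (gap_ideal _).
    + move=> f1 f2 [u1 [b1 [n1' c1]]] [u2 [b2 [n2 c2]]].
      exists (u1 * u2), (u2 * b1 + u1 * b2); split; first exact: centerM.
      have -> : u1 * u2 * (f1 + f2) - (u2 * b1 + u1 * b2) * z =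
        u2 * (u1 * f1 - b1 * z) + u1 * (u2 * f2 - b2 * z) by ring.
      by apply: idealD (gap_ideal _) _ _; apply: idealM (gap_ideal _) _.
    + move=> g f1 [u [b [nu c]]]; exists u, (g * b); split=> //.
      have -> : u * (g * f1) - g * b * z = g * (u * f1 - b * z) by ring.
      exact: idealM (gap_ideal _) _.
  have Sa := cf_val fa.
  have [e|ne] := eqVneq (ht v a j) h%:Z.
    have [u [w [nu nw euw]]] := x_unit_mul Sa S0 (etrans e (esym e0)).
    by exists u, w; split; rewrite // euw subrr; exact: ideal0 (gap_ideal _).
  exists 1, 0; split=> //; rewrite mul1r mul0r subr0 => b i.
  rewrite val_x // cf_mono; case: andP => [[/eqP <- /eqP <-] _|]; last by rewrite eqxx.
  by have [le_h|] := cf_ _ _ fa; [left; lia | right].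
Qed.

End AssociatedGradedRing.

Section Valuation.
(* B is integrally closed, hence the full ring of monomials of the cone *)
Hypothesis S_sat : forall a j m, (0 < m)%N -> pow_exp E (m * j) (a *+ m)%MM -> S a j.
Variable R : realType.

Definition monomial_val f : \bar R :=
  ereal_inf [set x | exists a j, cf (val f) a j != 0 /\ x = ((ht v a j)%:~R : R)%:E].

Definition order f (h : nat) := (forall a j, cf (val f) a j != 0 -> h%:Z <= ht v a j) /\
  exists a j, cf (val f) a j != 0 /\ ht v a j = h%:Z.

Lemma order_exists f : f != 0 -> exists h, order f h.
Proof.
move=> f0; have [a0 [j0 fa0]] : exists a j, cf (val f) a j != 0.
  by apply: cf_neq0; rewrite raddf_eq0.
pose P (h : nat) := `[< exists a j, cf (val f) a j != 0 /\ ht v a j = h%:Z >].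
have htN a j : cf (val f) a j != 0 -> exists2 h : nat, ht v a j = h%:Z & P h.
  move=> fa; have := S_ht vF (cf_val fa); case e : (ht v a j) => [h|h] // _.
  by exists h => //; apply/asboolP; exists a, j.
have exP : exists h, P h by have [h _ Ph] := htN _ _ fa0; exists h.
case: (ex_minnP exP) => h /asboolP ex_h h_min; exists h; split=> // a j /htN[m ->].
by rewrite lez_nat; exact: h_min.
Qed.

Lemma order_val f h : order f h -> monomial_val f = (h%:R)%:E.
Proof.
move=> [le_h [a [j [fa e]]]]; apply/eqP; rewrite eq_le; apply/andP; split.
  by apply: ereal_inf_lbound; exists a, j; rewrite e.
apply: le_ereal_inf_tmp => _ [b [i [fb ->]]].
by rewrite lee_fin -[h%:R]/(h%:Z%:~R) ler_int le_h.
Qed.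

Lemma order_uniq f h h' : order f h -> order f h' -> h = h'.
Proof.
move=> [le1 [a [j [fa e]]]] [le2 [b [i [fb e']]]].
by have := le1 _ _ fb; have := le2 _ _ fa; lia.
Qed.

Lemma orderM f g h h' : order f h -> order g h' -> order (f * g) (h + h').
Proof.
move=> [le1 ex1] [le2 ex2]; split.
  move=> a j; rewrite rmorphM => /cfM_neq0[a1 [j1 [a2 [j2 [-> -> /le1 h1 /le2 h2]]]]].
  by rewrite htD; lia.
have [|a [j [ne e]]] := weight_mul (htD v) ex1 ex2.
  by move=> a i b j /le1 h1 /le2 h2; lia.
by exists a, j; rewrite rmorphM.
Qed.

Lemma orderD f g h h' m : order f h -> order g h' -> order (f + g) m -> (minn h h' <= m)%N.
Proof.
move=> [le1 _] [le2 _] [_ [a [j [ne e]]]]; move: ne; rewrite rmorphD cfD => ne.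
have [e1|/le1] := eqVneq (cf (val f) a j) 0; last by lia.
by move: ne; rewrite e1 add0r => /le2; lia.
Qed.

Lemma order_notin f h : order f h -> center v f <-> (0 < h)%N.
Proof.
move=> [le1 [a [j [fa e]]]]; split=> [/(_ a j fa)|h_gt0 b i /le1]; lia.
Qed.

Lemma notin_order f : ~ center v f -> order f 0.
Proof.
move=> /(notin_center vF) [a [j [fa e]]]; split; last by exists a, j.
by move=> b i /cf_val Sb; exact: S_ht.
Qed.

Lemma order_x a j h : S a j -> ht v a j = h%:Z -> order (x_ a j) h.
Proof.
move=> Sa e; rewrite /order val_x //; split=> [b i|].
  by rewrite cf_mono; case: andP => [[/eqP <- /eqP <-]|]; rewrite ?e ?eqxx.
by exists a, j; rewrite cf_mono !eqxx oner_eq0.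
Qed.

Lemma ring_domain f g : f * g = 0 -> f = 0 \/ g = 0.
Proof.
have [->|/order_exists[h hf]] := eqVneq f 0; first by left.
have [->|/order_exists[h' hg]] := eqVneq g 0; first by right.
move=> e; have [_ [a [j []]]] := orderM hf hg.
by rewrite e rmorph0 cf0 eqxx.
Qed.

(** Up to face elements, a monomial of larger value is a multiple of one of smaller
    value. The quotient has a value h >= 0. Its M-th power, where M = v.2, has the value
    M h of X^(h a0), with a0 tight, from which it differs by face elements; so the
    quotient is in B up to a face element, by saturation. *)
Lemma divide a j a' j' : ht v a' j' <= ht v a j -> exists b i c d,
  [/\ face b i, S c d, (a + b = a' + c)%MM & (j + i = j' + d)%N].
Proof.
move=> le_ht; have [a0 [Ea0 ta0]] := tight_nonempty; have [M_gt0 _ _ _] := vF.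
pose M := v.2; pose h := `|ht v a j - ht v a' j'|%N.
have hE : ht v a j = ht v a' j' + h%:Z by rewrite /h; lia.
have htMn b i : ht v (b *+ M)%MM (M * i) = M%:Z * ht v b i.
  by rewrite /ht wtMn !PoszM; ring.
have e0 : ht v (a0 *+ h)%MM 0 = (h * M)%:Z by rewrite /ht wtMn ta0 muln0 subr0.
have [|b [i [b' [i' [fb fb' eb ei]]]]] :=
    @face_mul (a *+ M)%MM (a' *+ M + a0 *+ h)%MM (M * j)%N (M * j')%N.
  by rewrite -[(M * j')%N]addn0 htD !htMn e0 hE PoszM; ring.
have {}M_gt0 : (0 < M)%N := M_gt0.
clearbody M; clear htMn e0.
have M1 : (M = M.-1.+1)%N by rewrite prednK.
have le_a : (a' <= a + b)%MM.
  apply/mnm_lepP => x; rewrite -(leq_pmul2r M_gt0) mnmDE mulnDl.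
  have /mnmP/(_ x) := eb; rewrite !mnmDE !mulmnE => e.
  have le_b : (b x <= b x * M)%N by rewrite leq_pmulr.
  by move: e le_b; move: (a x * M)%N (a' x * M)%N (a0 x * h)%N (b x * M)%N; lia.
have le_j : (j' <= j + i)%N.
  rewrite -(leq_pmul2l M_gt0) mulnDr.
  have : (i <= M * i)%N by rewrite leq_pmull.
  by move: ei; move: (M * j)%N (M * j')%N (M * i)%N; lia.
exists b, i, (a + b - a')%MM, (j + i - j')%N; split=> //.
- apply: (S_sat M_gt0).
  have -> : (M * (j + i - j') = i' + M.-1 * i)%N.
    rewrite mulnBr mulnDr {2}M1 mulSn; move: ei.
    by move: (M * j)%N (M * j')%N (M.-1 * i)%N; lia.
  apply: (pow_exp_le (leqnn _) _ (pow_expD fb'.1 (pow_expM M.-1 fb.1))).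
  apply/mnm_lepP => x; have /mnmP/(_ x) := eb.
  rewrite !mnmDE !mulmnE mnmBE mnmDE mulnBl mulnDl => e.
  have : (b x * M = b x + b x * M.-1)%N by rewrite {1}M1 mulnS.
  move: e; move: (a x * M)%N (a' x * M)%N (a0 x * h)%N (b x * M)%N (b x * M.-1)%N.
  by lia.
- by rewrite [RHS]addmC submK.
- by rewrite subnKC.
Qed.

(** Primitivity gives a pair (c, q) of value 1, perhaps outside B, and a face element moves it
    into B. *)
Lemma uniformizer_exists : exists a j, S a j /\ ht v a j = 1.
Proof.
have [a0 [Ea0 ta0]] := tight_nonempty; have [M_gt0 _ [c ec] _] := vF.
have : wt v.1 (c + a0)%MM = 1 %[mod v.2] by rewrite wtD ta0 modnDr ec.
move=> /eqP; rewrite eqn_mod_dvd ?wtD ?ta0 ?ltn_addl // => /dvdnP[q eq].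
have e1 : ht v (c + a0)%MM q = 1 by rewrite /ht wtD ta0; move: eq; rewrite mulnC; move: (v.2 * q)%N; lia.
have [|b [i [d [j [[pb eb] Sd /(congr1 (wt v.1)) ea ej]]]]] := @divide (c + a0)%MM q 0%MM 0%N.
  by rewrite e1 /ht wt0 muln0.
exists d, j; split=> //; rewrite -e1 -[RHS]addr0 -eb -htD.
by rewrite /ht ea wtD wt0 ej.
Qed.

(** It is enough to divide each monomial of f by y ^+ h. The cofactor c is outside the
    center because orders add up. *)
Lemma order_factor y f h a j : S a j -> ht v a j = 1 -> y = x_ a j -> order f h ->
  exists u c, [/\ ~ center v u, ~ center v c & u * f = c * y ^+ h].
Proof.
move=> Sa ea -> of_; have [_ _ cM] := center_prime vF.
have n1 : ~ center v 1 by have [] := center_prime vF.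
have Sh : S (a *+ h)%MM (h * j) by exact: SMn.
have eh : ht v (a *+ h)%MM (h * j) = h%:Z.
  by move: ea; rewrite /ht wtMn mulnCA !PoszM -mulrBr => ->; rewrite mulr1.
rewrite xX //; set z := x_ _ _.
have oz : order z h by exact: order_x.
pose K : set B := [set f | exists u c, ~ center v u /\ u * f = c * z].
have [u [c [nu e]]] : K f.
  apply: ideal_of_monomials => [|b i fb].
    split.
    - by exists 1, 0; rewrite mulr0 mul0r.
    - move=> f1 f2 [u1 [c1 [n1' e1]]] [u2 [c2 [n2 e2]]].
      exists (u1 * u2), (u2 * c1 + u1 * c2); split; first by move=> /cM[].
      transitivity (u2 * (u1 * f1) + u1 * (u2 * f2)); first by ring.
      by rewrite e1 e2; ring.
    - move=> g f1 [u [c [nu e]]]; exists u, (g * c); split=> //.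
      by rewrite -mulrA -e; ring.
  have Sb := cf_val fb.
  have [|b' [i' [c [d [[pb eb] Sc ea' ei]]]]] := @divide b i (a *+ h)%MM (h * j)%N.
    by rewrite eh; have [le_h _] := of_; exact: le_h fb.
  exists (x_ b' i'), (x_ c d); split; first exact: face_notin.
  by rewrite !xM ?[(b' + b)%MM]addmC ?[(i' + i)%N]addnC ?ea' ?ei 1?addmC 1?addnC //; exact: S_pw.
exists u, c; split=> // cc; have := orderM (notin_order nu) of_; rewrite e add0n => oh.
have [c0|/order_exists[m om]] := eqVneq c 0.
  by have [_ [a1 [j1 []]]] := oh; rewrite c0 mul0r rmorph0 cf0 eqxx.
have m_gt0 : (0 < m)%N by exact/(order_notin om).
by have := order_uniq oh (orderM om oz); lia.
Qed.

Section Localized.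
Variables (L : comPzRingType) (th : B -> L).
Hypothesis thL : is_localization th [set 0] (center v).

Let centerM f g : ~ center v f -> ~ center v g -> ~ center v (f * g).
Proof. by have [_ _ cM] := center_prime vF; move=> nf ng /cM[]. Qed.

Let notin_center0 u : ~ center v u -> u <> 0.
Proof. by move=> nu u0; apply: nu; rewrite u0; apply: ideal0; have [] := center_prime vF. Qed.

Let th_eq0 f : th f = 0 -> f = 0.
Proof. by move=> /(loc_eq0 thL)[u nu /ring_domain[/(notin_center0 nu) //|]]. Qed.

Let th_inj f g : th f = th g -> f = g.
Proof.
move=> e; apply/eqP; rewrite -subr_eq0; apply/eqP/th_eq0.
by rewrite (locD thL) (locN thL) e subrr.
Qed.

Let loc_order (x : L) (h : nat) := exists f u, [/\ ~ center v u, th u * x = th f & order f h].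

Let loc_order_exists x : x <> 0 -> exists h, loc_order x h.
Proof.
move=> x0; have [f [u [nu e]]] := loc_surj thL x.
have [f0|/order_exists[h oh]] := eqVneq f 0; last by exists h, f, u.
exfalso; apply: x0; have [t et] := loc_unit thL nu.
by rewrite -[x]mul1r -et -mulrA e f0 (loc0 thL) mulr0.
Qed.

Let loc_order_uniq x h h' : loc_order x h -> loc_order x h' -> h = h'.
Proof.
move=> [f [u [nu e oh]]] [f' [u' [nu' e' oh']]].
have ef : u' * f = u * f' by apply: th_inj; rewrite !(locM thL) -e -e'; ring.
have o1 := orderM (notin_order nu') oh; have o2 := orderM (notin_order nu) oh'.
by rewrite ef in o1; have := order_uniq o1 o2.
Qed.

Let loc_order_neq0 x h : loc_order x h -> x <> 0.
Proof.
move=> [f [u [nu e [_ [a [j [fa _]]]]]]] x0; move: e; rewrite x0 mulr0 => /esym/th_eq0 f0.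
by rewrite f0 rmorph0 cf0 eqxx in fa.
Qed.

Let loc_orderM x y h h' : loc_order x h -> loc_order y h' -> loc_order (x * y) (h + h').
Proof.
move=> [f [u [nu e oh]]] [g [w [nw e' oh']]]; exists (f * g), (u * w).
split; [exact: centerM | rewrite !(locM thL) -e -e'; ring | exact: orderM].
Qed.

Let loc_orderD x y h h' m : loc_order x h -> loc_order y h' -> loc_order (x + y) m ->
  (minn h h' <= m)%N.
Proof.
move=> [f [u [nu e oh]]] [g [w [nw e' oh']]] om.
have o1 := orderM (notin_order nw) oh; have o2 := orderM (notin_order nu) oh'.
have esum : th (u * w) * (x + y) = th (w * f + u * g).
  by rewrite (locD thL) !(locM thL) -e -e'; ring.
have [f0|/order_exists[m' om']] := eqVneq (w * f + u * g) 0.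
  exfalso; apply: (loc_order_neq0 om); have [t et] := loc_unit thL (centerM nu nw).
  by rewrite -[_ + _]mul1r -et -mulrA esum f0 (loc0 thL) mulr0.
have <- : m' = m by apply: (loc_order_uniq _ om); exists (w * f + u * g), (u * w); split=> //; exact: centerM.
by have := orderD o1 o2 om'; rewrite !add0n.
Qed.

Let loc_order_dvd x y h h' : loc_order x h -> loc_order y h' -> (h <= h')%N ->
  exists c, y = c * x.
Proof.
move=> ox oy le_hh'; have [a [j [Sa ea]]] := uniformizer_exists.
have fac x' m : loc_order x' m -> exists p q, [/\ ~ center v p, ~ center v q &
    th p * x' = th q * th (x_ a j) ^+ m].
  move=> [f [u [nu e oh]]]; have [p [q [np nq epq]]] := order_factor Sa ea erefl oh.
  exists (p * u), q; split=> //; first exact: centerM.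
  have thX i : th (x_ a j ^+ i) = th (x_ a j) ^+ i.
    by elim: i => [|i IH]; rewrite ?expr0 ?(loc1 thL) // !exprS (locM thL) IH.
  by rewrite (locM thL) -mulrA e -(locM thL) epq (locM thL) thX.
have [p [q [np nq e]]] := fac _ _ ox; have [p' [q' [np' nq' e']]] := fac _ _ oy.
have [r er] := loc_unit thL nq; have [r' er'] := loc_unit thL np'.
exists (r' * th q' * th (x_ a j) ^+ (h' - h) * r * th p).
rewrite -!mulrA e [r * _]mulrA er mul1r -exprD subnK // -e' mulrA er' mul1r //.
Qed.

(** Every nonzero element is a unit times a power of a uniformizing monomial. *)
Theorem center_valuation : exists w : L -> \bar R,
  dvr_valuation w /\ forall f, w (th f) = monomial_val f.
Proof.
have wex x : exists r : \bar R, (x = 0 -> r = +oo%E) /\ forall h, loc_order x h -> r = (h%:R)%:E.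
  have [->|/eqP/loc_order_exists[h oh]] := eqVneq x 0.
    by exists +oo%E; split=> // h /loc_order_neq0.
  exists (h%:R)%:E; split=> [x0|h' oh']; first by case: (loc_order_neq0 oh).
  by rewrite (loc_order_uniq oh oh').
have [w wE] := choice wex.
have w0 : w 0 = +oo%E by have [->] := wE 0.
have wo x h : loc_order x h -> w x = (h%:R)%:E by have [_] := wE x; apply.
exists w; split; last first.
  move=> f; have [->|/order_exists[h oh]] := eqVneq f 0.
    rewrite (loc0 thL) w0 /monomial_val; rewrite (_ : [set x | _] = set0) ?ereal_inf0 //.
    by apply/seteqP; split=> // x [a [j []]]; rewrite rmorph0 cf0 eqxx.
  rewrite (order_val oh); apply: wo; exists f, 1; split=> //.
    by have [] := center_prime vF.
  by rewrite (loc1 thL) mul1r.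
split.
- move=> x; split=> [wx|->//]; apply: contrapT => /loc_order_exists[h /wo].
  by rewrite wx.
- by move=> x /loc_order_exists[h /wo]; exists h.
- move=> x y; have [->|/eqP/loc_order_exists[h oh]] := eqVneq x 0.
    rewrite mul0r w0 addye //; have [->|/eqP/loc_order_exists[h' /wo ->//]] := eqVneq y 0.
    by rewrite w0.
  have [->|/eqP/loc_order_exists[h' oh']] := eqVneq y 0.
    by rewrite mulr0 w0 (wo _ _ oh) addey.
  by rewrite (wo _ _ oh) (wo _ _ oh') (wo _ _ (loc_orderM oh oh')) natrD.
- move=> x y; have [->|/eqP/loc_order_exists[h oh]] := eqVneq x 0.
    by rewrite add0r ge_min lexx orbT.
  have [->|/eqP/loc_order_exists[h' oh']] := eqVneq y 0.
    by rewrite addr0 ge_min lexx.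
  have [->|/eqP/loc_order_exists[m om]] := eqVneq (x + y) 0; first by rewrite w0 leey.
  have := loc_orderD oh oh' om; rewrite (wo _ _ oh) (wo _ _ oh') (wo _ _ om).
  by rewrite ge_min !lee_fin !ler_nat geq_min.
- split.
    have [a [j [Sa ea]]] := uniformizer_exists; exists (th (x_ a j)).
    rewrite (wo _ 1%N) //; exists (x_ a j), 1; split; last exact: order_x.
      by have [] := center_prime vF.
    by rewrite (loc1 thL) mul1r.
  move=> x y; have [->|/eqP/loc_order_exists[h' oh']] := eqVneq y 0.
    by exists 0; rewrite mul0r.
  rewrite (wo _ _ oh'); have [->|/eqP/loc_order_exists[h oh]] := eqVneq x 0.
    by rewrite w0 leye_eq.
  by rewrite (wo _ _ oh) lee_fin ler_nat; exact: loc_order_dvd.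
Qed.

End Localized.

End Valuation.

End FacetLattice.

End Facets.
End MonomialRing.

(** * Monomial ideals and their Rees rings *)

Section MonomialIdeals.
Variables (k : fieldType) (n : nat) (I : ideal {mpoly k[n]}).
Local Notation A := {mpoly k[n]}.
Hypothesis I_monomial : monomial_ideal I.

Definition expset : set 'X_{1..n} := [set a | ideal_set I 'X_[a]].
Local Notation E := expset.

Lemma ideal_of_msupp (K : set A) (f : A) : is_ideal K ->
  (forall a, a \in msupp f -> K 'X_[a]) -> K f.
Proof.
move=> iK Kf; rewrite (mpolyE f) big_seq; apply: ideal_sum => // a /Kf Ka.
by rewrite -mul_mpolyC; exact: idealM.
Qed.

Lemma msupp_ideal (D : set 'X_{1..n}) : (forall a b, D b -> D (a + b)%MM) ->
  is_ideal [set f : A | forall a, a \in msupp f -> D a].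
Proof.
move=> DD; split=> [a|f g Df Dg a|f g Dg a]; first by rewrite msupp0.
  by move=> /msuppD_le; rewrite mem_cat => /orP[/Df|/Dg].
by move=> /msuppM_le/allpairsP[[b c] /= [_ /Dg Dc ->]]; exact: DD.
Qed.

Lemma expsetD a b : E b -> E (a + b)%MM.
Proof. by rewrite /expset /= mpolyXD => Eb; apply: idealM (idealP I) _. Qed.

Lemma monomial_idealP f : ideal_set I f <-> forall a, a \in msupp f -> E a.
Proof.
split=> [|Ef]; last exact: ideal_of_msupp (idealP I) Ef.
have [G eG] := I_monomial; have iE := msupp_ideal expsetD.
move: f; rewrite -/([set f | ideal_set I f] `<=` [set f : A | forall a, a \in msupp f -> E a]).
have -> : [set f | ideal_set I f] = ideal_gen [set 'X_[m] | m in G] by rewrite -eG.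
apply: ideal_gen_sub => // _ [m Gm <-] a; rewrite msuppX inE => /eqP ->.
by rewrite /expset /= eG; apply: sub_ideal_gen; exists m.
Qed.

Lemma pow_exp_decr j a b : pow_exp E j b -> pow_exp E j (a + b)%MM.
Proof. by move=> pb; rewrite -[j]add0n; apply: pow_expD pb; exact: pow_exp0. Qed.

Lemma ideal_expP j f : ideal_exp I j f <-> forall a, a \in msupp f -> pow_exp E j a.
Proof.
split; last first.
  move=> pf; apply: ideal_of_msupp (ideal_exp_ideal _ _) _ => a /pf[s [<- Es /submK <-]].
  rewrite mpolyXD; apply: idealM (ideal_exp_ideal _ _) _.
  elim: s Es => [//|x s IH] Es; rewrite big_cons mpolyXD; apply: ideal_expS; first exact/Es/mem_head.
  by apply: IH => y ys; apply: Es; rewrite inE ys orbT.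
have iK i := msupp_ideal (@pow_exp_decr i).
move: f; elim: j => [|j IH]; first by move=> f _ a _; exact: pow_exp0.
apply: (ideal_expS_sub (iK j.+1)) => f g /monomial_idealP If /IH pg a.
move=> /msuppM_le/allpairsP[[b c] /= [/If Eb /pg pc ->]].
by rewrite -add1n; apply: pow_expD => //; exact: pow_exp1.
Qed.

Lemma ideal_expX j a : ideal_exp I j 'X_[a] <-> pow_exp E j a.
Proof.
rewrite ideal_expP; split=> [|pa b]; first by apply; rewrite msuppX inE.
by rewrite msuppX inE => /eqP ->.
Qed.

(** If a multiple m z is a sum of m exponents in E, then X^z is a root of
    T^m - X^(m z), an equation of integral dependence on I. *)
Lemma integrally_closed_convex : integrally_closed I -> lattice_convex E.
Proof.
move=> icI z p c Ep m_gt0 ez; rewrite /expset /= -icI.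
set m := (\sum_i c i)%N in m_gt0 ez.
exists m, (fun i => if i == m then - 'X_[z] ^+ m else 0); split=> // [i _|].
  case: eqP => [->|_]; last exact: ideal0 (ideal_exp_ideal _ _).
  apply: idealN (ideal_exp_ideal _ _) _; rewrite mpolyXn ez; apply/ideal_expX.
  exact: pow_exp_sum.
rewrite (big_nat_recr m) //= eqxx subnn expr0 mulr1 big_nat big1 ?add0r ?subrr // => i /andP[_ lt_im].
by rewrite ltn_eqF // mul0r.
Qed.

Lemma rees_val_inj : injective (@rees_val A I).
Proof. exact: val_inj. Qed.

Lemma rees_im p : (exists b, rees_val (I := I) b = p) <-> forall a j, cf p a j != 0 -> pow_exp E j a.
Proof.
split=> [[b <-] a j|pE].
  by rewrite /cf -mcoeff_msupp; have /ideal_expP := rees_valP b j; apply.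
have Ip : p \in rees_pred I.
  by apply/asboolP => j; apply/ideal_expP => a ap; apply: pE; rewrite /cf -mcoeff_msupp.
by exists (Rees Ip).
Qed.

Lemma gr_idealP f : ideal_set (gr_ideal I) f <->
  forall a j, cf (rees_val f) a j != 0 -> pow_exp E j.+1 a.
Proof.
split=> [If a j|pE j].
  by rewrite /cf -mcoeff_msupp; have /ideal_expP := If j; apply.
by apply/ideal_expP => a ap; apply: pE; rewrite /cf -mcoeff_msupp.
Qed.

End MonomialIdeals.

(** * Integral closure of a monomial ideal *)

Section DilatedMonomials.
Variables (k : numFieldType) (n : nat).
Local Notation A := {mpoly k[n]}.

(** The automorphism that doubles one variable. *)
Definition dilate (i : 'I_n) : A -> A :=
  mmap (@mpolyC n k) (fun j => (if j == i then 2 else 1 : k) *: 'X_j).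

HB.instance Definition _ i := GRing.RMorphism.copy (dilate i)
  (mmap (@mpolyC n k) (fun j => (if j == i then 2 else 1 : k) *: 'X_j)).

Lemma dilateX i a : dilate i 'X_[a] = 2 ^+ a i *: 'X_[a].
Proof.
rewrite /dilate mmapX /mmap1 [in RHS]mpolyXE_id.
under eq_bigr do rewrite exprZn.
rewrite scaler_prod (bigD1 i) //= eqxx big1 ?mulr1 // => j ji.
by rewrite (negPf ji) expr1n.
Qed.

Lemma mcoeff_dilate i f a : (dilate i f)@_a = 2 ^+ a i * f@_a.
Proof.
have -> : dilate i f = \sum_(m <- msupp f) (2 ^+ m i * f@_m) *: 'X_[m].
  rewrite [f in dilate i f]mpolyE /dilate raddf_sum /=; apply: eq_bigr => m _.
  by rewrite mmapZ -/(dilate i _) dilateX mul_mpolyC scalerA mulrC.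
rewrite raddf_sum /=; under eq_bigr do rewrite mcoeffZ mcoeffX.
have [af|af] := boolP (a \in msupp f); last first.
  rewrite (memN_msupp_eq0 af) mulr0 big_seq big1 // => b bf.
  by case: (b =P a) => [eba|_]; rewrite ?mulr0 //; rewrite -eba bf in af.
rewrite (bigD1_seq a) ?msupp_uniq //= eqxx mulr1 big1 ?addr0 // => b ba.
by rewrite (negPf ba) mulr0.
Qed.

(** Monomials are common eigenvectors of the dilations, separated by their
    eigenvalues: if a and b differ in the variable i, then dilate i - 2 ^+ b i kills
    X^b and rescales X^a. *)
Lemma dilation_stable_monomials (K : set A) :
  is_ideal K -> (forall i f, K f -> K (dilate i f)) ->
  forall f a, K f -> a \in msupp f -> K 'X_[a].
Proof.
move=> iK Kdil f; have [s] := ubnP (size (msupp f)); elim: s f => // s IH f lt_s a Kf af.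
have fa0 : f@_a != 0 by rewrite -mcoeff_msupp.
have [[b [bf nba]]|only_a] := pselect (exists b, b \in msupp f /\ b != a).
  have [i neq_i] : exists i, a i != b i.
    apply: contrapT => h; move/negP: nba; apply; apply/eqP/mnmP => i.
    by apply: contrapT => e; apply: h; exists i; rewrite eq_sym; apply/eqP.
  pose g := dilate i f - 2 ^+ b i *: f.
  have gE m : g@_m = (2 ^+ m i - 2 ^+ b i) * f@_m.
    by rewrite mcoeffB mcoeff_dilate mcoeffZ mulrBl.
  have gsub : {subset msupp g <= rem b (msupp f)}.
    move=> m; rewrite mcoeff_msupp gE mulf_eq0 => /norP[ne fm].
    rewrite (rem_filter b (msupp_uniq f)) mem_filter mcoeff_msupp fm andbT /=.
    by apply: contra_neq ne => ->; rewrite subrr.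
  apply: (IH g).
  - apply: leq_ltn_trans (uniq_leq_size (msupp_uniq g) gsub) _.
    rewrite size_rem //; move: lt_s; case: (msupp f) bf => //= *; lia.
  - apply: idealD (Kdil i f Kf) _ => //; apply: idealN => //.
    by rewrite -mul_mpolyC; exact: idealM.
  - rewrite mcoeff_msupp gE mulf_neq0 // subr_eq0.
    by rewrite -!natrX eqr_nat eqn_exp2l.
have fE : f = f@_a *: 'X_[a].
  apply/mpolyP => m; rewrite mcoeffZ mcoeffX; case: (a =P m) => [<-|nam]; first by rewrite mulr1.
  rewrite mulr0; apply/eqP/negPn/negP; rewrite -mcoeff_msupp => mf; apply: only_a.
  by exists m; split=> //; rewrite eq_sym; apply/eqP.
have -> : 'X_[a] = (f@_a)^-1%:MP * f.
  by rewrite {2}fE mul_mpolyC scalerA mulVf // scale1r.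
exact: idealM.
Qed.

Section ReesIntegralClosure.
Variables (I : ideal {mpoly k[n]}).
Hypothesis I_monomial : monomial_ideal I.
Local Notation E := (expset I).

(** The exponents of the monomials in the integral closure of the j-th power of I. *)
Definition pow_closure_exp (a : 'X_{1..n}) (j : nat) :=
  exists2 m, (0 < m)%N & pow_exp E (m * j) (a *+ m)%MM.

Lemma integral_closure_ideal j : is_ideal (integral_closure (ideal_exp I j)).
Proof.
split=> [|f g|f g].
- by apply/integral_closure_integralOver; rewrite scale0r; exact: integral0.
- move=> /integral_closure_integralOver If /integral_closure_integralOver Ig.
  by apply/integral_closure_integralOver; rewrite scalerDl; exact: integral_add.
- move=> /integral_closure_integralOver Ig; apply/integral_closure_integralOver.
  have -> : f * g *: 'X^j = f *: 'X^0 * (g *: 'X^j).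
    by rewrite -scalerAl -scalerAr scalerA expr0 mul1r.
  apply: integral_mul => //; apply/integral_closure_integralOver.
  by have /asboolP/(_ 0%N) := polyC_rees_ic I f; rewrite coefC.
Qed.

Lemma dilate_power i j f : ideal_exp I j f -> ideal_exp I j (dilate i f).
Proof.
move=> /(ideal_expP I_monomial) pf; apply/(ideal_expP I_monomial) => a.
rewrite mcoeff_msupp mcoeff_dilate mulf_eq0 => /norP[_ fa].
by apply: pf; rewrite mcoeff_msupp.
Qed.

Lemma dilate_integral_closure i j f :
  integral_closure (ideal_exp I j) f -> integral_closure (ideal_exp I j) (dilate i f).
Proof.
move=> [m [c [m_gt0 Ic fc]]]; exists m, (fun h => dilate i (c h)).
split; [exact: m_gt0 | by move=> h /Ic; rewrite ideal_expM; exact: dilate_power |].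
have := congr1 (dilate i) fc; rewrite rmorph0 rmorphD rmorphXn rmorph_sum => e.
by rewrite -[RHS]e; congr (_ + _); apply: eq_bigr => h _; rewrite rmorphM rmorphXn.
Qed.

(** In an equation of degree m for X^a, the monomial X^(m a) cancels, so it occurs in
    some term c X^((m - h) a), and then X^(h a) occurs in c. *)
Lemma integral_closureX j a : integral_closure (ideal_exp I j) 'X_[a] <-> pow_closure_exp a j.
Proof.
split=> [[m [c [m_gt0 Ic ac]]]|[m m_gt0 pm]].
  have [h [/andP[h_gt0 le_hm] ch]] : exists h, (0 < h <= m)%N /\ (c h)@_(a *+ h)%MM != 0.
    apply: contrapT => nh; have := congr1 (mcoeff (a *+ m)%MM) ac.
    rewrite mcoeffD mcoeff0 mpolyXn mcoeffX eqxx raddf_sum /= big_nat big1 ?addr0 => [/eqP|h hm].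
      by rewrite oner_eq0.
    rewrite mpolyXn; have -> : (a *+ m = a *+ (m - h) + a *+ h)%MM.
      by apply/mnmP => x; rewrite mnmDE !mulmnE -mulnDr subnK //; case/andP: hm.
    rewrite mcoeffMX; apply/eqP/negPn/negP => ch; apply: nh; exists h; split=> //.
  exists h => //; have := Ic h; rewrite h_gt0 le_hm ideal_expM => /(_ isT).
  by move=> /(ideal_expP I_monomial); apply; rewrite mcoeff_msupp.
exists m, (fun i => if i == m then - 'X_[a] ^+ m else 0); split=> // [i _|].
  case: eqP => [->|_]; last exact: ideal0 (ideal_exp_ideal _ _).
  rewrite ideal_expM; apply: idealN (ideal_exp_ideal _ _) _.
  by rewrite mpolyXn; apply/(ideal_expX I_monomial).
rewrite (big_nat_recr m) //= eqxx subnn expr0 mulr1 big_nat big1 ?add0r ?subrr // => i /andP[_ lt_im].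
by rewrite ltn_eqF // mul0r.
Qed.

(** Dilations preserve the powers of I, hence their integral closures. *)
Lemma integral_closureP j f : integral_closure (ideal_exp I j) f <->
  forall a, a \in msupp f -> pow_closure_exp a j.
Proof.
split=> [If a af|pf].
  apply/integral_closureX; apply: dilation_stable_monomials If af.
    exact: integral_closure_ideal.
  by move=> i g; exact: dilate_integral_closure.
apply: ideal_of_msupp (integral_closure_ideal j) _ => a /pf pa.
exact/integral_closureX.
Qed.

Definition rees_ic_val : rees_ic I -> {poly A} := \val.
HB.instance Definition _ := GRing.RMorphism.copy rees_ic_val \val.

Lemma rees_ic_valD f g : rees_ic_val (f + g) = rees_ic_val f + rees_ic_val g.
Proof. exact: rmorphD. Qed.

Lemma rees_ic_valM f g : rees_ic_val (f * g) = rees_ic_val f * rees_ic_val g.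
Proof. exact: rmorphM. Qed.

Lemma rees_ic_val_inj : injective rees_ic_val.
Proof. exact: val_inj. Qed.

Lemma rees_ic_im p : (exists b, rees_ic_val b = p) <-> forall a j, cf p a j != 0 -> pow_closure_exp a j.
Proof.
split=> [[b <-] a j|pE].
  rewrite /cf -mcoeff_msupp; have /asboolP/(_ j)/integral_closureP := valP b; apply.
have Ip : p \in rees_ic_pred I.
  by apply/asboolP => j; apply/integral_closureP => a ap; apply: pE; rewrite /cf -mcoeff_msupp.
by exists (ReesIc Ip).
Qed.

Lemma pow_exp_closure a j : pow_exp E j a -> pow_closure_exp a j.
Proof. by exists 1%N => //; rewrite mul1n. Qed.

(** An element of I^(j+1) is a sum of products of an element of I with one of I^j, the
    latter times t^j being in the ring. *)
Lemma rees_ic_ext_monomial (P : spec (rees_ic I)) a j : rees_ic_ext I `<=` P -> pow_exp E j.+1 a ->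
  prime_set P (x_ rees_ic_val a j).
Proof.
move=> extP; have [iP _ _] := Defs.primeP P.
pose K : set A := [set f | exists2 b, rees_ic_val b = f *: 'X^j & prime_set P b].
have iK : is_ideal K.
  split.
  - by exists 0; rewrite ?rmorph0 ?scale0r //; exact: ideal0.
  - move=> f g [b eb Pb] [c ec Pc]; exists (b + c); last exact: idealD.
    by rewrite rees_ic_valD eb ec scalerDl.
  - move=> f g [c ec Pc]; exists (to_rees_ic I f * c); last exact: idealM.
    by rewrite rees_ic_valM ec /= mul_polyC scalerA.
have IK : ideal_exp I j.+1 `<=` K.
  apply: ideal_expS_sub => // f g If Ig.
  have [b eb] : exists b, rees_ic_val b = g *: 'X^j.
    apply/rees_ic_im => c i; rewrite /cf coefZ coefXn; case: (i =P j) => [->|_]; last first.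
      by rewrite mulr0 mcoeff0 eqxx.
    rewrite mulr1 -mcoeff_msupp => cg; apply: pow_exp_closure.
    by have /(ideal_expP I_monomial) := Ig; apply.
  exists (to_rees_ic I f * b); first by rewrite rees_ic_valM eb /= mul_polyC scalerA.
  rewrite mulrC; apply: idealM => //; apply: extP; apply: sub_ideal_gen.
  by exists f.
move=> pa; have /IK[b eb Pb] : ideal_exp I j.+1 'X_[a] by apply/(ideal_expX I_monomial).
suff -> : x_ rees_ic_val a j = b by [].
apply: rees_ic_val_inj; rewrite eb (val_x rees_ic_im) //; apply: pow_exp_closure.
by apply: pow_exp_le pa => //; exact: lepm_refl.
Qed.

End ReesIntegralClosure.
End DilatedMonomials.

(** * Zero-dimensional monomial ideals *)

Lemma kernel_prime (A : comPzRingType) (D : idomainType) (h : {rmorphism A -> D}) :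
  is_prime_ideal [set a | h a = 0].
Proof.
split; first split=> /=.
- exact: rmorph0.
- by move=> a b ha hb; rewrite rmorphD ha hb addr0.
- by move=> a b hb; rewrite rmorphM hb mulr0.
- by rewrite /= rmorph1 => /eqP; rewrite oner_eq0.
- by move=> a b /= /eqP; rewrite rmorphM mulf_eq0 => /orP[/eqP|/eqP]; [left|right].
Qed.

Section ZeroDimensional.
Variables (R : realType) (k : fieldType) (n : nat) (I : ideal {mpoly k[n]}).
Hypothesis I_monomial : monomial_ideal I.
Hypothesis I_dim0 : zero_dimensional_ideal R I.
Local Notation A := {mpoly k[n]}.

Lemma dim0_no_chain (P Q : spec A) : I `<=` P -> P `<=` Q -> Q `<=` P.
Proof.
move=> IP PQ; have IQ : I `<=` Q by move=> f /IP/PQ.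
have [P' eP] := push_exists IP; have [Q' eQ] := push_exists IQ.
apply: contrapT => nQP.
suff : (1%:E <= krull_dim R (quot_ring I))%E by rewrite I_dim0 lee_fin ler10.
apply: ereal_sup_ubound; exists 1%N => //; exists (fun i => if i is 0%N then P' else Q').
case=> //= _; split; first by apply/pull_le; rewrite eP eQ.
by move=> /pull_le; rewrite eP eQ.
Qed.

(** Otherwise the i-th axis lies in the zero set of I, and its ideal P is strictly
    contained in the ideal Q of the origin. *)
Lemma dim0_pure_power (i : 'I_n) : exists m, expset I (U_(i) *+ m)%MM.
Proof.
apply: contrapT => no_m.
pose h : {rmorphism A -> {poly k}} :=
  mmap (@polyC k) (fun j : 'I_n => if j == i then 'X else 0).
pose P := Spec (kernel_prime h).
pose ev : {rmorphism {poly k} -> k} := horner_eval 0.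
pose Q := Spec (kernel_prime (ev \o h)).
have hXi : h 'X_i = 'X by rewrite /h /= mmapX mmap1U eqxx.
have IP : I `<=` P.
  move=> f /(monomial_idealP I_monomial) If; rewrite /P /=.
  rewrite (mpolyE f) raddf_sum big_seq big1 // => a /If Ea.
  rewrite -mul_mpolyC [LHS]rmorphM; apply/eqP; rewrite mulf_eq0; apply/orP; right.
  rewrite /h /= mmapX /mmap1.
  have [j [ji aj]] : exists j, j != i /\ (0 < a j)%N.
    apply: contrapT => nj; apply: no_m; exists (a i).
    suff <- : a = (U_(i) *+ a i)%MM by [].
    apply/mnmP => j; rewrite mulmnE mnm1E; case: eqP => [<-|/eqP ij]; first by rewrite mul1n.
    rewrite mul0n; apply/eqP; rewrite eqn0Ngt; apply/negP => aj; apply: nj.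
    by exists j; rewrite eq_sym.
  by rewrite (bigD1 j) //= (negPf ji) expr0n eqn0Ngt aj /= mul0r.
have PQ : P `<=` Q by move=> f /= hf; rewrite /= hf rmorph0.
have : prime_set P 'X_i.
  apply: (dim0_no_chain IP PQ); rewrite /Q /=.
  by rewrite hXi /horner_eval hornerX.
by rewrite /P /= hXi => /eqP; rewrite polyX_eq0.
Qed.

Lemma dim0_pure_powers : exists2 N, (0 < N)%N & forall i, expset I (U_(i) *+ N)%MM.
Proof.
have [m mE] := choice dim0_pure_power.
exists (\sum_i m i).+1 => // i.
have -> : (U_(i) *+ (\sum_i m i).+1 = U_(i) *+ ((\sum_i m i).+1 - m i) + U_(i) *+ m i)%MM.
  apply/mnmP => j; rewrite mnmDE !mulmnE -mulnDr subnK //.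
  by apply: leqW; rewrite (bigD1 i) //= leq_addr.
exact: expsetD.
Qed.

End ZeroDimensional.

(** * Comparison of the two sums *)

Section Comparison.
Variables (R : realType) (k : numFieldType) (n : nat) (I : ideal {mpoly k[n]}).
Hypothesis n_le3 : (0 < n <= 3)%N.
Hypothesis I_monomial : monomial_ideal I.
Hypothesis I_dim0 : zero_dimensional_ideal R I.
Hypothesis I_closed : integrally_closed I.
Local Notation A := {mpoly k[n]}.
Local Notation E := (expset I).
Local Notation facets := [set v | is_facet E v].

Let n_gt0 : (0 < n)%N. Proof. by case/andP: n_le3. Qed.
Let E_convex := integrally_closed_convex I_monomial I_closed.
Let pow_exp_self a j : pow_exp E j a -> pow_exp E j a. Proof. by []. Qed.
Let pow_exp_once a j : pow_exp E j a -> exists2 m, (0 < m)%N & pow_exp E (m * j) (a *+ m)%MM.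
Proof. by exists 1%N => //; rewrite mul1n. Qed.

Lemma gr_minimal_primes (P : spec (rees I)) : minimal_primes (gr_ideal I) P <->
  exists2 v, is_facet E v & (P : set _) = center (@rees_val A I) v.
Proof.
have [N N_gt0 EU] := dim0_pure_powers I_monomial I_dim0.
apply: (minimal_primes_centers (@rees_val_inj _ _ I) (rees_im I_monomial) EU
  pow_exp_self pow_exp_once N_gt0 n_gt0).
- move=> Q JQ a j pa; apply: JQ; apply/(gr_idealP I_monomial) => b i.
  have pja : pow_exp E j a by apply: pow_exp_le pa => //; exact: lepm_refl.
  rewrite (val_x (rees_im I_monomial) pja) cf_mono.
  by case: andP => [[/eqP <- /eqP <-] //|_]; rewrite eqxx.
- move=> v [M_gt0 EM _ _] f /(gr_idealP I_monomial) Jf a j /Jf /(pow_exp_wt EM).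
  rewrite mulnS /ht; move: (v.2 * j)%N M_gt0; lia.
Qed.

Lemma behrend_nu_facets : behrend_nu R I = \esum_(v in facets) (v.2%:R)%:E.
Proof.
have [N N_gt0 EU] := dim0_pure_powers I_monomial I_dim0.
have facet_of (Q : spec (gr I)) : exists v, minimal_primes [set 0] Q ->
    is_facet E v /\ (pull Q : set _) = center (@rees_val A I) v.
  have [Qmin|nQ] := pselect (minimal_primes [set 0] Q); last by exists ([ffun=> 0%N], 0%N).
  by have /pull_minimal/gr_minimal_primes[v vF e] := Qmin; exists v.
have [g gE] := choice facet_of.
rewrite (reindex_esum (minimal_primes [set 0 : gr I]) facets g); last first.
  split.
  - by move=> Q /gE[].
  - move=> Q Q'; rewrite !inE => /gE[_ e] /gE[_ e'] eg; apply: pull_inj; apply: spec_eq.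
    by rewrite e e' eg.
  - move=> v vF; pose P := center_spec (rees_im I_monomial) pow_exp_once vF.
    have Pmin : minimal_primes (gr_ideal I) P by apply/gr_minimal_primes; exists v.
    have [Q eQ] := push_exists (proj1 Pmin).
    have Qmin : minimal_primes [set 0] Q by apply/pull_minimal; rewrite eQ.
    exists Q => //; have [gF e] := gE _ Qmin.
    apply: (center_sub_inj (rees_im I_monomial) pow_exp_self pow_exp_once n_gt0 gF vF).
    by rewrite -e eQ.
apply: eq_esum => Q /gE[gF e].
apply: (length_at_center (@rees_val_inj _ _ I) (rees_im I_monomial) EU pow_exp_self pow_exp_once n_le3 E_convex gF pow_exp_self
  (gr_idealP I_monomial)).
rewrite -e; exact: quot_localization.
Qed.

Let pow_closure_exp_of_pow a j : pow_exp E j a -> pow_closure_exp I a j. Proof. exact: pow_exp_closure. Qed.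
Let pow_closure_exp_id a j : pow_closure_exp I a j -> exists2 m, (0 < m)%N & pow_exp E (m * j) (a *+ m)%MM.
Proof. by []. Qed.
Let pow_closure_exp_sat a j m : (0 < m)%N -> pow_exp E (m * j) (a *+ m)%MM -> pow_closure_exp I a j.
Proof. by exists m. Qed.

Lemma cf_to_rees_ic f a j : cf (rees_ic_val (to_rees_ic I f)) a j != 0 -> a \in msupp f /\ j = 0%N.
Proof.
rewrite /cf /= coefC; case: (j =P 0%N) => [-> fa|_]; last by rewrite mcoeff0 eqxx.
by rewrite mcoeff_msupp.
Qed.

Lemma rees_ic_minimal_primes (P : spec (rees_ic I)) : minimal_primes (rees_ic_ext I) P <->
  exists2 v, is_facet E v & (P : set _) = center (@rees_ic_val k n I) v.
Proof.
have [N N_gt0 EU] := dim0_pure_powers I_monomial I_dim0.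
apply: (minimal_primes_centers (@rees_ic_val_inj _ _ I) (rees_ic_im I_monomial) EU
  pow_closure_exp_of_pow pow_closure_exp_id N_gt0 n_gt0).
- by move=> Q extQ a j; exact: rees_ic_ext_monomial.
- move=> v vF; have [iC _ _] := center_prime (rees_ic_im I_monomial) pow_closure_exp_id vF.
  apply: ideal_gen_sub => // _ [f If <-] a j /cf_to_rees_ic[fa ->].
  have [M_gt0 EM _ _] := vF; rewrite /ht muln0 subr0.
  have /EM : E a by have /(monomial_idealP I_monomial) := If; apply.
  by move: M_gt0; lia.
Qed.

(** The least weight of a monomial of f. *)
Definition facet_val (v : {ffun 'I_n -> nat} * nat) (f : A) : \bar R :=
  monomial_val (@rees_ic_val k n I) v R (to_rees_ic I f).

Lemma rees_valuationP u : rees_valuations R I u <-> exists2 v, is_facet E v & u = facet_val v.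
Proof.
have [N N_gt0 EU] := dim0_pure_powers I_monomial I_dim0.
have val_ex v (vF : is_facet E v) (Q : spec (rees_ic I)) : (Q : set _) = center (@rees_ic_val k n I) v ->
    exists w : loc Q -> \bar R,
      dvr_valuation w /\ forall f, w (to_loc Q f) = monomial_val (@rees_ic_val k n I) v R f.
  move=> eQ; apply: (center_valuation (@rees_ic_val_inj _ _ I) (rees_ic_im I_monomial) EU
    pow_closure_exp_of_pow pow_closure_exp_id n_le3 E_convex vF pow_closure_exp_sat R).
  rewrite -eQ; exact: to_loc_localization.
split=> [[Q [w [Qmin dw ->]]]|[v vF ->]].
  have /rees_ic_minimal_primes[v vF eQ] := Qmin; exists v => //.
  have [w' [dw' w'E]] := val_ex v vF Q eQ.
  by rewrite (dvr_valuation_unique dw dw'); apply: funext => f; rewrite w'E.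
pose Q := center_spec (rees_ic_im I_monomial) pow_closure_exp_id vF.
have [w [dw wE]] := val_ex v vF Q erefl; exists Q, w; split=> //.
  by apply/rees_ic_minimal_primes; exists v.
by apply: funext => f; rewrite wE.
Qed.

Implicit Types (v : {ffun 'I_n -> nat} * nat) (f : A).

Lemma facet_val_ge v f (h : nat) : (forall a, a \in msupp f -> (h <= wt v.1 a)%N) ->
  ((h%:R)%:E <= facet_val v f)%E.
Proof.
move=> le_h; apply: le_ereal_inf_tmp => _ [a [j [/cf_to_rees_ic[fa ->] ->]]].
rewrite lee_fin /ht muln0 subr0 -[h%:R]/(h%:Z%:~R) ler_int lez_nat; exact: le_h.
Qed.

Lemma facet_valX v a : facet_val v 'X_[a] = ((wt v.1 a)%:R)%:E.
Proof.
apply/eqP; rewrite eq_le facet_val_ge ?andbT => [|b]; last by rewrite msuppX inE => /eqP ->.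
apply: ereal_inf_lbound; exists a, 0%N; split; last by rewrite /ht muln0 subr0.
by rewrite /cf /= coefC eqxx mcoeffX eqxx oner_eq0.
Qed.

Lemma facet_val_ideal v : is_facet E v -> val_ideal (facet_val v) I = (v.2%:R)%:E.
Proof.
move=> vF; have [N N_gt0 EU] := dim0_pure_powers I_monomial I_dim0.
have [a [Ea ta]] := tight_nonempty EU n_le3 E_convex vF.
have [_ EM _ _] := vF; apply/eqP; rewrite eq_le; apply/andP; split.
  by apply: ereal_inf_lbound; exists 'X_[a]; rewrite ?facet_valX ?ta.
apply: le_ereal_inf_tmp => _ [f /(monomial_idealP I_monomial) If <-].
by apply: facet_val_ge => b /If; exact: EM.
Qed.

Lemma facet_val_inj v v' : is_facet E v -> is_facet E v' -> facet_val v = facet_val v' -> v = v'.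
Proof.
case: v v' => [l M] [l' M'] vF v'F e; have := facet_val_ideal vF.
rewrite e (facet_val_ideal v'F) => -[] /eqP; rewrite eqr_nat => /eqP /= eM.
congr (_, _) => //; apply/ffunP => i.
have := facet_valX (l, M) U_(i)%MM; rewrite e facet_valX /= !wtU => -[] /eqP.
by rewrite eqr_nat => /eqP.
Qed.

Lemma rees_valuations_facets :
  \esum_(u in rees_valuations R I) val_ideal u I = \esum_(v in facets) (v.2%:R)%:E.
Proof.
rewrite (reindex_esum facets (rees_valuations R I) facet_val); last first.
  split.
  - by move=> v vF; apply/rees_valuationP; exists v.
  - by move=> v v'; rewrite !inE; exact: facet_val_inj.
  - by move=> u /rees_valuationP[v vF ->]; exists v.
by apply: eq_esum => v; exact: facet_val_ideal.
Qed.

Theorem behrend_nu_rees_valuations :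
  behrend_nu R I = \esum_(u in rees_valuations R I) val_ideal u I.
Proof. by rewrite behrend_nu_facets rees_valuations_facets. Qed.

End Comparison.

Theorem corollary4p15 (R : realType) (n : nat) (I : ideal {mpoly R[i][n]}) :
  (0 < n <= 3)%N ->
  monomial_ideal I ->
  zero_dimensional_ideal R I ->
  integrally_closed I ->
  behrend_nu R I =
    \esum_(v in rees_valuations R I) val_ideal v I.
Proof. exact: (@behrend_nu_rees_valuations R R[i] n I). Qed.
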